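(* Let $c(x,\cdot)$ be $C^1(\mathcal Y)$ and assume that there exist $\Lambda\in(0,+\infty)$ and $N\ge2$ such that $y\mapsto c(x,y)+\psi^n_\varepsilon(y)$ is $\Lambda$-semiconcave uniformly in $x\in\mathrm{supp}(\rho)$ and $n\ge N-1$. (i) If there exists $\tau\in(0,+\infty)$ such that $\nu$ satisfies $\mathrm{TI}(\tau)$, then for all $n\ge N-1$ $$\mathscr H(\pi^\nu_\varepsilon|\pi^{n+1,n+1})\le\mathscr H(\pi^\nu_\varepsilon|\pi^{n+1,n})\le\Big(1-\frac{\min\{\tau\Lambda,\varepsilon\}}{\min\{\tau\Lambda,\varepsilon\}+\tau\Lambda}\Big)^{n-N+2}\mathscr H(\pi^\nu_\varepsilon|\pi^{0,0}).$$ (ii) If there exists $\tau\in(0,+\infty)$ such that $\nu^{n,n-1}$ satisfies $\mathrm{TI}(\tau)$ for all $n\ge N$, then for all $n\ge N$ $$\mathscr H(\pi^\nu_\varepsilon|\pi^{n+1,n+1})\le\mathscr H(\pi^\nu_\varepsilon|\pi^{n+1,n})\le\Big(1-\frac{\varepsilon}{\varepsilon+\tau\Lambda}\Big)^{n-N+1}\mathscr H(\pi^\nu_\varepsilon|\pi^{0,0}).$$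
   Context: $\mathcal X$ is a Polish space; $(\mathcal Y,\mathfrak g)$ is a (possibly unbounded) connected Riemannian manifold without boundary with Riemannian distance $\mathsf d$. $\rho\in\mathcal P(\mathcal X)$, $\nu\in\mathcal P(\mathcal Y)$, $c:\mathcal X\times\mathcal Y\to\mathbb R$ is a cost and $\varepsilon>0$. $\Pi(\cdot,\cdot)$ is the set of couplings, $\mathscr H(p|q)=\int\log\frac{dp}{dq}\,dp$ (equal to $+\infty$ if $p\not\ll q$) is the relative entropy, and $\mathbf W_2^2(\mu,\nu)=\inf_{\pi\in\Pi(\mu,\nu)}\int\mathsf d^2\,d\pi$. $\pi^\nu_\varepsilon$ is the unique minimizer of $\inf_{\pi\in\Pi(\rho,\nu)}\int c\,d\pi+\varepsilon\mathscr H(\pi|\rho\otimes\nu)$; throughout, $c$ satisfies mild integrability conditions ensuring that it exists and has $\rho\otimes\nu$-density $\exp(-(c+\varphi_\varepsilon^\nu(x)+\psi_\varepsilon^\nu(y))/\varepsilon)$ for some potentials $\varphi_\varepsilon^\nu,\psi_\varepsilon^\nu$. Sinkhorn's algorithm: starting from $\varphi^0_\varepsilon$ (typically $0$), for $n\ge0$, $$\psi^n_\varepsilon(y)=\varepsilon\log\int_{\mathcal X}e^{-\frac{c(x,y)+\varphi^n_\varepsilon(x)}{\varepsilon}}\rho(dx),\qquad \varphi^{n+1}_\varepsilon(x)=\varepsilon\log\int_{\mathcal Y}e^{-\frac{c(x,y)+\psi^n_\varepsilon(y)}{\varepsilon}}\nu(dy).$$ Sinkhorn plans $\pi^{n,n}$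 and $\pi^{n+1,n}$ have $\rho\otimes\nu$-densities $e^{-(c+\varphi^n_\varepsilon(x)+\psi^n_\varepsilon(y))/\varepsilon}$ and $e^{-(c+\varphi^{n+1}_\varepsilon(x)+\psi^n_\varepsilon(y))/\varepsilon}$ respectively. $\nu^{n+1,n}$ is the second marginal of $\pi^{n+1,n}$, i.e. $d\nu^{n+1,n}=e^{-(\psi^n_\varepsilon-\psi^{n+1}_\varepsilon)/\varepsilon}d\nu$. The initialization $\varphi^0_\varepsilon$ is assumed smooth enough that one may differentiate under the integral sign along the iterates, i.e. $\nabla\psi^n_\varepsilon(y)=-\int\nabla_2c(x,y)\,\pi^{n,n}(dx|y)$, where $\pi^{n,n}(dx|y)=e^{-(c(x,y)+\varphi^n_\varepsilon(x)+\psi^n_\varepsilon(y))/\varepsilon}\rho(dx)$. A probability measure $\nu$ satisfies Talagrand's inequality $\mathrm{TI}(\tau)$ if $\mathbf W_2^2(\mu,\nu)\le2\tau\,\mathscr H(\mu|\nu)$ for all $\mu\in\mathcal P(\mathcal Y)$. A differentiable $f:\mathcal Y\to\mathbb R$ is $\Lambda$-semiconcave if for all $z,y\in\mathcal Y$ and any geodesic $(\gamma_t)_{t\in[0,1]}$ with $\gamma_0=y$, $\gamma_1=z$, $f(z)-f(y)\le\langle\nabla f(y),\dot\gamma_0\rangle_{\mathfrak g}+\frac\Lambda2\mathsf d(z,y)^2$. Geodesics are constant-speed and length-minimizing, and any two points of $\mathcal Y$ are understood to be joined by one. *)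

(* Defs.v *)
From HB Require Import structures.
From mathcomp Require Import all_boot all_order all_algebra.
From mathcomp Require Import all_classical all_reals all_analysis.

Set Implicit Arguments.
Unset Strict Implicit.
Unset Printing Implicit Defensive.

Import Order.TTheory GRing.Theory Num.Theory.
Import numFieldNormedType.Exports.

Local Open Scope classical_set_scope.
Local Open Scope ring_scope.
Local Open Scope charge_scope.

(** * Riemannian manifolds *)

(* [U] is meant to be open, so that the derivatives do not depend on the values
   of [f] outside [U]. *)
Fixpoint Ck (R : realType) (V W : normedModType R) (k : nat) (U : set V)
    (f : V -> W) : Prop :=
  match k with
  | 0 => forall x, U x -> {for x, continuous f}
  | k'.+1 => (forall x, U x -> differentiable f x) /\
             (forall v, Ck k' U (fun x => 'D_v f x))
  end.

Definition smooth_on (R : realType) (V W : normedModType R) (U : set V)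
    (f : V -> W) : Prop := forall k, Ck k U f.

(* An [m]-dimensional smooth manifold without boundary with a Riemannian metric.
   The atlas is indexed by the points of [Y], [chart p] being a chart around
   [p]; every atlas contains one of this form. [gram p x] is the Gram matrix of
   the metric in the chart [p], at the point of coordinates [x]. With row
   vectors, ['J f x] is the transpose of the usual Jacobian matrix. *)
Record riemannian_manifold (R : realType) (m : nat) (Y : ptopologicalType) :=
  RiemannianManifold {
  chart_dom : Y -> set Y ;
  chart : Y -> Y -> 'rV[R]_m ;
  chart_inv : Y -> 'rV[R]_m -> Y ;
  gram : Y -> 'rV[R]_m -> 'M[R]_m ;
  manifold_hausdorff : hausdorff_space Y ;
  manifold_second_countable : @second_countable Y ;
  chart_dom_open : forall p, open (chart_dom p) ;
  chart_dom_center : forall p, chart_dom p p ;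
  chart_codom_open : forall p, open (chart p @` chart_dom p) ;
  chartK : forall p y, chart_dom p y -> chart_inv p (chart p y) = y ;
  chart_continuous :
    forall p y, chart_dom p y -> {for y, continuous (chart p)} ;
  chart_inv_continuous :
    forall p x, (chart p @` chart_dom p) x -> {for x, continuous (chart_inv p)} ;
  transition_smooth : forall p q,
    smooth_on (chart p @` (chart_dom p `&` chart_dom q))
              (chart q \o chart_inv p) ;
  gram_smooth : forall p, smooth_on (chart p @` chart_dom p) (gram p) ;
  gram_sym : forall p x, (chart p @` chart_dom p) x -> (gram p x)^T = gram p x ;
  gram_posdef : forall p x, (chart p @` chart_dom p) x ->
    forall v : 'rV[R]_m, v != 0 -> 0 < (v *m gram p x *m v^T) 0 0 ;
  gram_transition : forall p q x,
    (chart p @` (chart_dom p `&` chart_dom q)) x ->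
    gram p x = 'J (chart q \o chart_inv p) x
               *m gram q (chart q (chart_inv p x))
               *m ('J (chart q \o chart_inv p) x)^T
}.

Section riemannian.
Context (R : realType) (m : nat) (Y : ptopologicalType).
Variable M : riemannian_manifold R m Y.

(* A tangent vector at [y] is given by its coordinates in the chart [y]. *)
Definition riem_inner (y : Y) (u v : 'rV[R]_m) : R :=
  (u *m gram M y (chart M y y) *m v^T) 0 0.

Definition riem_norm (y : Y) (u : 'rV[R]_m) : R := Num.sqrt (riem_inner y u u).

Definition mdifferentiable (f : Y -> R) (y : Y) : Prop :=
  differentiable (f \o chart_inv M y : 'rV[R]_m -> R^o) (chart M y y).

Definition C1_fun (f : Y -> R) : Prop :=
  forall p, Ck 1 (chart M p @` chart_dom M p)
                 (f \o chart_inv M p : 'rV[R]_m -> R^o).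

Definition mpartials (f : Y -> R) (y : Y) : 'rV[R]_m :=
  \row_i 'D_(delta_mx 0 i) (f \o chart_inv M y : 'rV[R]_m -> R^o) (chart M y y).

(* Its inner product with [v] is the differential of [f] applied to [v]. *)
Definition mgrad (f : Y -> R) (y : Y) : 'rV[R]_m :=
  mpartials f y *m invmx (gram M y (chart M y y)).

Definition velocity (g : R -> Y) (t : R) : 'rV[R]_m :=
  derive1 (chart M (g t) \o g : R -> 'rV[R]_m) t.

(* A curve is a total function on the reals of which only the restriction to
   [0, 1] matters; being C^1 up to the end points is expressed by being C^1 on a
   neighbourhood of [0, 1], as every C^1 curve on [0, 1] extends to one. *)
Definition C1_curve (g : R -> Y) : Prop :=
  forall t, t \in `[0, 1] ->
    [/\ {for t, continuous g},
        \forall s \near t, derivable (chart M (g t) \o g : R -> 'rV[R]_m) s 1 &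
        {for t, continuous (derive1 (chart M (g t) \o g : R -> 'rV[R]_m))}].

Definition curve_length (g : R -> Y) : R :=
  \int[lebesgue_measure]_(t in `[0, 1]) riem_norm (g t) (velocity g t).

(* The velocity of a C^1 curve may vanish, so piecewise C^1 curves (once
   reparametrized) give the same infimum. *)
Definition riem_dist (y z : Y) : R :=
  inf [set curve_length g | g in
        [set g | [/\ C1_curve g, g 0 = y & g 1 = z]]].

Definition geodesic (g : R -> Y) : Prop :=
  [/\ C1_curve g,
      exists s, forall t, t \in `[0, 1] -> riem_norm (g t) (velocity g t) = s &
      curve_length g = riem_dist (g 0) (g 1)].

Definition semiconcave (L : R) (f : Y -> R) : Prop :=
  (forall y, mdifferentiable f y) /\
  (forall z y g, geodesic g -> g 0 = y -> g 1 = z ->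
     f z - f y <= riem_inner y (mgrad f y) (velocity g 0)
                  + L / 2 * riem_dist z y ^+ 2).

End riemannian.

(** * Measures *)

Notation borel X := (g_sigma_algebraType (@open X)).

(* Complete is meant for the uniform structure induced by the balls, which comes
   from a metric when the space is Hausdorff. *)
Definition polish (R : realType) (X : completePseudoMetricType R) : Prop :=
  hausdorff_space X /\ exists S : set X, countable S /\ dense S.

Definition supp (R : realType) (X : ptopologicalType)
    (rho : probability (borel X) R) : set X :=
  [set x | forall U : set X, open U -> U x -> (0 < rho U)%E].

HB.instance Definition _ d1 d2 (T1 : measurableType d1)
    (T2 : measurableType d2) :=
  isMeasurableFun.Build _ _ (T1 * T2)%type T2 (@snd T1 T2) measurable_snd.

Section measures.
Context (R : realType).

Definition has_density d (T : measurableType d) (p q : probability T R)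
    (f : T -> R) : Prop :=
  forall A, measurable A -> p A = (\int[q]_(z in A) (f z)%:E)%E.

Definition couplings d1 d2 (T1 : measurableType d1) (T2 : measurableType d2)
    (p : probability T1 R) (q : probability T2 R) :
    set (probability (T1 * T2)%type R) :=
  [set pi | (forall A, measurable A -> pi (A `*` setT) = p A) /\
            (forall B, measurable B -> pi (setT `*` B) = q B)].

(* The negative part of the integrand is always [p]-integrable. *)
Definition rel_entropy d (T : measurableType d) (p q : probability T R) :
    \bar R :=
  if `[< p `<< q >]
  then (\int[p]_z lne (('d (charge_of_finite_measure p) '/d q) z))%E
  else +oo%E.

Definition second_marginal d1 d2 (T1 : measurableType d1)
    (T2 : measurableType d2) (p : probability (T1 * T2)%type R) :
    probability T2 R :=
  distribution p (@snd T1 T2 : {mfun (T1 * T2)%type >-> T2}).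

End measures.

Section talagrand.
Context (R : realType) (m : nat) (Y : ptopologicalType).
Variable M : riemannian_manifold R m Y.

Definition W2_sq (mu nu : probability (borel Y) R) : \bar R :=
  ereal_inf [set (\int[pi]_z ((riem_dist M z.1 z.2) ^+ 2)%:E)%E
            | pi in couplings mu nu].

Definition TI (nu : probability (borel Y) R) (tau : R) : Prop :=
  forall mu : probability (borel Y) R,
    (W2_sq mu nu <= (2 * tau)%:E * rel_entropy mu nu)%E.

End talagrand.

(** * Entropic optimal transport and Sinkhorn's algorithm *)

Section eot.
Context (R : realType) (X Y : ptopologicalType).
Variables (c : X -> Y -> R) (eps : R).
Variables (rho : probability (borel X) R) (nu : probability (borel Y) R).

Definition eot_density (phi : X -> R) (psi : Y -> R) (z : X * Y) : R :=
  expR (- (c z.1 z.2 + phi z.1 + psi z.2) / eps).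

(* Couplings for which the integral of [c] is not finite are not competitors;
   this avoids assigning a value to undefined integrals. *)
Definition eot_cost (pi : probability (borel X * borel Y)%type R) : \bar R :=
  if `[< pi.-integrable setT (fun z => (c z.1 z.2)%:E) >]
  then (\int[pi]_z (c z.1 z.2)%:E + eps%:E * rel_entropy pi (rho \x nu))%E
  else +oo%E.

Definition unique_eot_minimizer
    (pi : probability (borel X * borel Y)%type R) : Prop :=
  couplings rho nu pi /\
  forall pi', couplings rho nu pi' ->
    (eot_cost pi <= eot_cost pi')%E /\
    ((eot_cost pi' <= eot_cost pi)%E ->
     forall A, measurable A -> pi' A = pi A).

Definition sinkhorn_psi_step (phi : X -> R) (y : Y) : R :=
  eps * ln (\int[rho]_x expR (- (c x y + phi x) / eps)).

(* Where the integral is infinite (a [rho]-negligible set of points for the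
   iterates below) the value is a junk one, as [fine +oo = 0] and [ln 0 = 0]. *)
Definition sinkhorn_phi_step (psi : Y -> R) (x : X) : R :=
  eps * ln (\int[nu]_y expR (- (c x y + psi y) / eps)).

Fixpoint sinkhorn_phi (phi0 : X -> R) (n : nat) : X -> R :=
  match n with
  | 0 => phi0
  | k.+1 => sinkhorn_phi_step (sinkhorn_psi_step (sinkhorn_phi phi0 k))
  end.

Definition sinkhorn_psi (phi0 : X -> R) (n : nat) : Y -> R :=
  sinkhorn_psi_step (sinkhorn_phi phi0 n).

End eot.

(* Main.v *)
Require Import Defs.
From HB Require Import structures.
From mathcomp Require Import all_boot all_order all_algebra ring lra zify.
From mathcomp Require Import all_classical all_reals all_analysis.
From mathcomp Require Import measurable_realfun.

Set Implicit Arguments.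
Unset Strict Implicit.
Unset Printing Implicit Defensive.

Import Order.TTheory GRing.Theory Num.Theory.
Import numFieldNormedType.Exports.

Local Open Scope classical_set_scope.
Local Open Scope ring_scope.

(** Sinkhorn's iterates satisfy the chain rules
      [H(pinu|plan n n) = S n + H(pinu|plan n.+1 n)] and
      [H(pinu|plan n.+1 n) = T n + H(pinu|plan n.+1 n.+1)],
    where [S n] is the entropy of [rho] relative to the first marginal of
    [plan n n], and [T n] that of [nu] relative to the second marginal [mu n] of
    [plan n.+1 n] (lemmas [rel_entropy_phi_step] and [rel_entropy_psi_step]). In
    particular the entropies decrease; a geometric rate follows as soon as the
    entropy left after a step is bounded by a multiple of the decrease.

    The bound comes from semiconcavity. Let [Q_y] be the conditional law of [x]
    given [y] for [plan n n]. The gradient of [c x + psi n] at [y] has mean zero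
    under [Q_y], so that averaging the semiconcavity inequality along a geodesic
    from [y] to [z] gives
      [H(Q_y|Q_z) <= Lambda / (2 * eps) * d(z, y)^2],
    proved in the Donsker-Varadhan form
      [\int t dQ_y - ln \int expR t dQ_z <= Lambda / (2 * eps) * d(z, y)^2]
    for bounded [t] (lemma [semiconcave_stability]). Both sides are integrated
    over a coupling of [nu] (variable [z]) and [mu n.-1] (variable [y]). As the
    [Q_y] averaged over [mu n.-1] give [rho], the integral of the left-hand side
    becomes the one, over [pinu], of [t x - ln \int expR t dQ_z], and the test
    functions [t] tending to [(phi n - phinu) / eps] make it tend to
    [H(pinu|plan n n)]. Hence (lemma [rel_entropy_plan_le_transport])
      [H(pinu|plan n n) <= Lambda / (2 * eps) * \int d(z, y)^2],
    for all couplings. The potentials may fail to be integrable one by one; this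
    is why [t] is bounded and the limit is taken last, by Fatou's lemma.

    Talagrand's inequality turns the transport cost into an entropy: [T n.-1] if
    [mu n.-1] satisfies it, and the entropy of [mu n.-1] relative to [nu] if [nu]
    does, which is at most [S n.-1] because [mu n.-1] and [nu] are images of two
    plans whose relative entropy is [S n.-1] (lemma
    [rel_entropy_marginal_nu_le]). The entropy remaining after a step is thus at
    most [tau * Lambda / eps] times the decrease, whence the rates. *)

(** * Integrals of functions that are bounded below *)

Section integration.
Context d (T : measurableType d) (R : realType).
Local Open Scope ereal_scope.

(** The integral of a nonnegative function is a supremum over the simple
    functions below it, so that monotonicity holds for arbitrary functions. It
    is applied to the square of the Riemannian distance, which is not known to
    be measurable. *)
Lemma le_integral_nomeas (mu : {measure set T -> \bar R}) (f g : T -> \bar R) :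
  (forall x, f x <= g x) -> \int[mu]_x f x <= \int[mu]_x g x.
Proof.
have ge0_le (h k : T -> \bar R) : (forall x, 0 <= h x) ->
    (forall x, h x <= k x) -> \int[mu]_x h x <= \int[mu]_x k x.
  move=> h0 hk; rewrite !ge0_integralTE//; last first.
    by move=> x; exact: le_trans (hk x).
  apply: ereal_sup_le => _ [s sh <-]; exists s => // x.
  exact: le_trans (hk x).
move=> fg; rewrite (integralE _ _ f) (integralE _ _ g); apply: leeB.
  by apply: ge0_le => x; [|rewrite !funeposE ge_max !le_max fg lexx/= orbT].
by apply: ge0_le => x; [|rewrite !funenegE ge_max !le_max leeN2 fg lexx/= orbT].
Qed.

(** Relative entropies are integrals of functions that are bounded below by
    integrable ones: they may be infinite, and they still add up. *)
Lemma integralD_bounded_below (mu : {measure set T -> \bar R})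
    (a b ga gb : T -> R) :
  measurable_fun setT a -> measurable_fun setT b ->
  mu.-integrable setT (EFin \o ga) -> mu.-integrable setT (EFin \o gb) ->
  (forall x, ga x <= a x)%R -> (forall x, gb x <= b x)%R ->
  \int[mu]_x (a x + b x)%:E = \int[mu]_x (a x)%:E + \int[mu]_x (b x)%:E.
Proof.
move=> ma mb iga igb gaa gbb.
(* first for a nonnegative function, whose integral may be infinite, plus an
   integrable one *)
have key (f g : T -> R) : measurable_fun setT f -> (forall x, 0 <= f x)%R ->
    mu.-integrable setT (EFin \o g) ->
    \int[mu]_x (f x + g x)%:E = \int[mu]_x (f x)%:E + \int[mu]_x (g x)%:E.
  move=> mf f0 ig.
  have mg : measurable_fun setT g by apply/measurable_EFinP/(measurable_int _ ig).
  have gfin : \int[mu]_x (g x)%:E \is a fin_num.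
    exact: (integrable_fin_num measurableT ig).
  have f0' : 0 <= \int[mu]_x (f x)%:E.
    by apply: integral_ge0 => x _; rewrite lee_fin.
  have [iflt|ifoo] := ltP (\int[mu]_x (f x)%:E) +oo.
    have If : mu.-integrable setT (EFin \o f).
      apply/integrableP; split; first exact/measurable_EFinP.
      by under eq_integral do rewrite /= ger0_norm//.
    by rewrite -(integralD_EFin measurableT If ig).
  move: ifoo; rewrite leye_eq => /eqP ifoo; rewrite ifoo addye; last first.
    by rewrite gt_eqF// ltNye_eq gfin.
  rewrite integralE.
  have mfg : measurable_fun setT (fun x => (f x + g x)%:E).
    by apply/measurable_EFinP; exact: measurable_funD.
  have ngfin : \int[mu]_x (fun x => (f x + g x)%:E)^\- x \is a fin_num.
    rewrite ge0_fin_numE; last by apply: integral_ge0.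
    have /integrableP[_] := ig; apply: le_lt_trans.
    apply: le_integral_nomeas => x /=; rewrite funenegE -EFinN -EFin_max.
    rewrite lee_fin ge_max normr_ge0 andbT.
    by have := ler_norm (- g x)%R; rewrite normrN; have := f0 x; lra.
  suff -> : \int[mu]_x (fun x => (f x + g x)%:E)^\+ x = +oo.
    by rewrite addye// gt_eqF// ltNye_eq fin_numN ngfin.
  apply/eqP; rewrite -leye_eq -ifoo leNgt; apply/negP => pf.
  have : \int[mu]_x (f x)%:E < +oo.
    apply: (@le_lt_trans _ _
      (\int[mu]_x ((fun x => (f x + g x)%:E)^\+ x + `|(g x)%:E|))).
      apply: le_integral_nomeas => x.
      rewrite funeposE -EFin_max/= -EFinD lee_fin.
      have : (f x + g x <= Num.max (f x + g x) 0)%R by rewrite le_max lexx.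
      by have := ler_norm (- g x)%R; rewrite normrN; lra.
    rewrite ge0_integralD//; [|exact: measurable_funepos|]; last first.
      by apply: measurableT_comp => //; exact/measurable_EFinP.
    by rewrite lte_add_pinfty// ?(lt_le_trans pf)// ?leey//; have /integrableP[] := ig.
  by rewrite ifoo.
have mga : measurable_fun setT ga by apply/measurable_EFinP/(measurable_int _ iga).
have mgb : measurable_fun setT gb by apply/measurable_EFinP/(measurable_int _ igb).
have ea : \int[mu]_x (a x)%:E = \int[mu]_x (a x - ga x)%:E + \int[mu]_x (ga x)%:E.
  rewrite -key//; last by move=> x; rewrite subr_ge0.
    by apply: eq_integral => x _; rewrite subrK.
  exact: measurable_funB.
have eb : \int[mu]_x (b x)%:E = \int[mu]_x (b x - gb x)%:E + \int[mu]_x (gb x)%:E.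
  rewrite -key//; last by move=> x; rewrite subr_ge0.
    by apply: eq_integral => x _; rewrite subrK.
  exact: measurable_funB.
have -> : \int[mu]_x (a x + b x)%:E =
    \int[mu]_x (((a x - ga x) + (b x - gb x)) + (ga x + gb x))%:E.
  by apply: eq_integral => x _; congr (_%:E); lra.
rewrite (key (fun x => a x - ga x + (b x - gb x))%R (fun x => ga x + gb x)%R).
- have -> : \int[mu]_x (ga x + gb x)%:E = \int[mu]_x (ga x)%:E + \int[mu]_x (gb x)%:E.
    exact: (integralD_EFin measurableT iga igb).
  under eq_integral do rewrite EFinD.
  rewrite ge0_integralD//.
  + by rewrite ea eb addeACA.
  + by move=> x _; rewrite lee_fin subr_ge0.
  + by apply/measurable_EFinP; exact: measurable_funB.
  + by move=> x _; rewrite lee_fin subr_ge0.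
  + by apply/measurable_EFinP; exact: measurable_funB.
- by apply: measurable_funD; exact: measurable_funB.
- by move=> x; apply: addr_ge0; rewrite subr_ge0.
- exact: (integrableD measurableT iga igb).
Qed.

End integration.

(** * Densities and relative entropy *)

Section density.
Context d (T : measurableType d) (R : realType).
Implicit Types (p q r : probability T R) (f g : T -> R) (h : T -> \bar R).
Local Open Scope ereal_scope.

Lemma has_density_dominates p r f : measurable_fun setT f ->
  has_density p r f -> p `<< r.
Proof.
move=> mf pf; apply/null_content_dominatesP => A mA rA.
rewrite pf// null_set_integral//.
by apply/measurable_EFinP; exact: measurable_funTS.
Qed.

Lemma ge0_integral_density p r f h :
  measurable_fun setT f -> (forall x, 0 <= f x)%R -> has_density p r f ->
  measurable_fun setT h -> (forall x, 0 <= h x) ->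
  \int[p]_x h x = \int[r]_x (h x * (f x)%:E).
Proof.
move=> mf f0 pf mh h0.
have pr := has_density_dominates mf pf.
rewrite -(Radon_Nikodym_SigmaFinite.change_of_variables pr)//.
have intRN := Radon_Nikodym_SigmaFinite.f_integrable pr.
have mRN := measurable_int _ intRN.
apply: ae_eq_integral => //.
- exact: emeasurable_funM.
- by apply: emeasurable_funM => //; exact/measurable_EFinP.
- apply: ae_eqe_mul2l; apply: integral_ae_eq => //.
    exact/measurable_EFinP.
  by move=> E _ mE; rewrite -pf// -Radon_Nikodym_SigmaFinite.f_integral.
Qed.

(** The chain rule [dp/dq = (dp/dr) / (dq/dr)], where [dq/dr] is positive. *)
Lemma has_density_div p q r f g :
  measurable_fun setT f -> (forall x, 0 <= f x)%R -> has_density p r f ->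
  measurable_fun setT g -> (forall x, 0 < g x)%R -> has_density q r g ->
  has_density p q (fun x => f x / g x)%R.
Proof.
move=> mf f0 pf mg g0 qg A mA.
have mfg : measurable_fun setT (fun x => f x / g x)%R.
  (* writing the inverse with [expR] and [ln] shows its measurability *)
  have -> : (fun x => f x / g x)%R = (fun x => f x * expR (- ln (g x)))%R.
    by apply/funext => x; rewrite expRN lnK// posrE.
  apply: measurable_funM => //; apply: (measurableT_comp (@measurable_expR R)).
  exact: (measurable_funN (measurableT_comp (@measurable_ln R) mg)).
rewrite pf// integral_mkcond [RHS]integral_mkcond.
rewrite (ge0_integral_density mg _ qg).
- apply: eq_integral => x _; rewrite !patchE; case: ifPn => _.
    by rewrite -EFinM divfK// gt_eqF.
  by rewrite mul0e.
- by move=> x; exact: ltW.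
- apply/measurable_restrict => //; apply: measurable_funTS.
  exact/measurable_EFinP.
- by apply: erestrict_ge0 => x _; rewrite lee_fin divr_ge0// ltW.
Qed.

(** The Radon-Nikodym derivative in the relative entropy is only determined
    almost everywhere; the integral of its logarithm is that of the logarithm of
    any positive density. *)
Lemma rel_entropy_expR p q (t : T -> R) : measurable_fun setT t ->
  has_density p q (fun x => expR (t x)) ->
  rel_entropy p q = \int[p]_x (t x)%:E.
Proof.
move=> mt pq.
have me : measurable_fun setT (fun x => expR (t x)).
  exact: measurableT_comp.
have dom := has_density_dominates me pq.
rewrite /rel_entropy asboolT//.
set D := Radon_Nikodym _ _.
have {}dom : charge_of_finite_measure p `<< q := dom.
have iD : q.-integrable setT D by exact: Radon_Nikodym_integrable.
have mD : measurable_fun setT D := measurable_int _ iD.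
have Dt : ae_eq p setT D (EFin \o (fun x => expR (t x))).
  apply: null_dominates_ae_eq (has_density_dominates me pq) _ => //.
  apply: integral_ae_eq => //; first exact/measurable_EFinP.
  move=> E _ mE; transitivity (p E); last exact: pq.
  by rewrite -Radon_Nikodym_integral.
apply: ae_eq_integral => //.
- have -> : (fun z => lne (D z)) =
      (fun z => if (fine (D z) <= 0)%R then -oo else (ln (fine (D z)))%:E).
    apply/funext => z.
    have := Radon_Nikodym_fin_num z dom.
    by rewrite -/D; case: (D z).
  apply: measurable_fun_ifT => //.
  + apply: measurable_fun_ler => //; exact: measurableT_comp.
  + apply/measurable_EFinP; apply: measurableT_comp; first exact: measurable_ln.
    exact: measurableT_comp.
- exact/measurable_EFinP.
- apply: filterS Dt => x /(_ I) -> _.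
  by rewrite [X in lne X]/= lne_EFin ?expR_gt0// expRK.
Qed.

End density.

(** * Log-likelihood ratios and couplings *)

(** If [t] is the logarithm of a density [dp/dq], then [expR (- t)] has integral
    at most [1] under [p], and [1 - expR (- t) <= t] is an integrable lower
    bound. Nonnegativity and additivity of relative entropies follow, for infinite
    values too. *)
Section log_likelihood.
Context d (T : measurableType d) (R : realType) (p : probability T R).
Implicit Types s t : T -> R.
Local Open Scope ereal_scope.

Lemma integrable_expRN t : measurable_fun setT t ->
  \int[p]_x (expR (- t x))%:E < +oo ->
  p.-integrable setT (fun x => (expR (- t x))%:E).
Proof.
move=> mt et; apply/integrableP; split.
  apply/measurable_EFinP/(measurableT_comp (@measurable_expR R)).
  exact: measurable_funN.
by under eq_integral do rewrite /= ger0_norm ?expR_ge0//.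
Qed.

Lemma integrable_sub1_expRN t : measurable_fun setT t ->
  \int[p]_x (expR (- t x))%:E < +oo ->
  p.-integrable setT (fun x => (1 - expR (- t x))%:E).
Proof.
move=> mt et.
have := integrableB measurableT (finite_measure_integrable_cst p 1 measurableT)
  (integrable_expRN mt et).
exact: eq_integrable.
Qed.

Let sub1_expRN_le (x : R) : (1 - expR (- x) <= x)%R.
Proof. by have := expR_ge1Dx (- x); lra. Qed.

Lemma integral_expRN_sub1 t : measurable_fun setT t ->
  \int[p]_x (expR (- t x))%:E = 1 -> \int[p]_x (expR (- t x) - 1)%:E = 0.
Proof.
move=> mt et; rewrite integralB_EFin//.
- by rewrite et integral_cst//= mul1e probability_setT subee.
- by apply: integrable_expRN => //; rewrite et ltry.
- exact: finite_measure_integrable_cst.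
Qed.

Lemma integral_loglik_ge0 t : measurable_fun setT t ->
  \int[p]_x (expR (- t x))%:E = 1 -> 0 <= \int[p]_x (t x)%:E.
Proof.
move=> mt et.
apply: (@le_trans _ _ (\int[p]_x (1 - expR (- t x))%:E)); last first.
  by apply: le_integral_nomeas => x; rewrite lee_fin.
rewrite integralB_EFin//.
- by rewrite et integral_cst//= mul1e probability_setT subee.
- exact: finite_measure_integrable_cst.
- by apply: integrable_expRN => //; rewrite et ltry.
Qed.

Lemma integral_loglikD s t : measurable_fun setT s -> measurable_fun setT t ->
  \int[p]_x (expR (- s x))%:E < +oo -> \int[p]_x (expR (- t x))%:E < +oo ->
  \int[p]_x (s x + t x)%:E = \int[p]_x (s x)%:E + \int[p]_x (t x)%:E.
Proof.
move=> ms mt es et.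
apply: integralD_bounded_below ms mt (integrable_sub1_expRN ms es)
  (integrable_sub1_expRN mt et) _ _ => x; exact: sub1_expRN_le.
Qed.

End log_likelihood.

Section coupling.
Context d1 d2 (T1 : measurableType d1) (T2 : measurableType d2) (R : realType).
Variables (p : probability T1 R) (q : probability T2 R).
Variables (pi : probability (T1 * T2)%type R).
Local Open Scope ereal_scope.

Lemma integral_image d d' (U : measurableType d) (V : measurableType d')
    (m : probability U R) (m' : probability V R) (f : U -> V)
    (h : V -> \bar R) : measurable_fun setT f ->
  (forall A, measurable A -> m' A = m (f @^-1` A)) ->
  measurable_fun setT h -> \int[m]_x h (f x) = \int[m']_x h x.
Proof.
move=> mf mm' mh; rewrite integralE [RHS]integralE.
have ge0 (k : V -> \bar R) : measurable_fun setT k -> (forall x, 0 <= k x) ->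
    \int[m]_x k (f x) = \int[m']_x k x.
  move=> mk k0; have := @ge0_integral_pushforward _ _ _ _ _ _ mf m setT k
    measurableT mk (fun x _ => k0 x).
  rewrite preimage_setT => <-; apply: eq_measure_integral => A mA _.
  exact/esym/mm'.
by rewrite -!ge0//;
  [congr (_ - _); apply: eq_integral => x _; rewrite ?funeposE ?funenegE
  |exact: measurable_funeneg|exact: measurable_funepos].
Qed.

Hypothesis pipq : couplings p q pi.

Lemma integral_coupling1 (h : T1 -> \bar R) : measurable_fun setT h ->
  \int[pi]_z h z.1 = \int[p]_x h x.
Proof.
apply: integral_image => // A mA; rewrite -pipq.1//; congr (pi _).
by apply/seteqP; split => -[x y] //= [].
Qed.

Lemma integral_coupling2 (h : T2 -> \bar R) : measurable_fun setT h ->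
  \int[pi]_z h z.2 = \int[q]_x h x.
Proof.
apply: integral_image => // A mA; rewrite -pipq.2//; congr (pi _).
by apply/seteqP; split => -[x y] //= [].
Qed.

End coupling.

(** * Normalization by Sinkhorn's steps *)

Section normalization.
Context d (T : measurableType d) (R : realType) (p : probability T R).
Local Open Scope ereal_scope.

Lemma integral_expR_gt0 (g : T -> R) : measurable_fun setT g ->
  0 < \int[p]_x (expR (g x))%:E.
Proof.
move=> mg; rewrite lt0e integral_ge0 ?andbT; last first.
  by move=> x _; rewrite lee_fin expR_ge0.
apply/eqP => ig0.
have mf : measurable_fun setT (fun x => (expR (g x))%:E).
  by apply/measurable_EFinP; exact: measurableT_comp.
have [+ _] := @ae_eq_integral_abs _ _ _ p setT measurableT _ mf.
have -> : \int[p]_x `|(expR (g x))%:E| = 0.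
  by rewrite -ig0; apply: eq_integral => x _; rewrite gee0_abs// lee_fin expR_ge0.
move=> /(_ erefl)[N [mN pN sN]].
have : p setT <= p N.
  apply: le_measure; rewrite ?inE// => x _; apply: sN => /= /(_ I) [] /eqP.
  by rewrite gt_eqF// expR_gt0.
by rewrite pN probability_setT lee_fin ler10.
Qed.

Lemma integral_expR_normalized (g : T -> R) : measurable_fun setT g ->
  \int[p]_x (expR (g x))%:E < +oo ->
  \int[p]_x (expR (g x - ln (\int[p]_x expR (g x))%R))%:E = 1.
Proof.
move=> mg ilt.
have i0 := integral_expR_gt0 mg.
have ifin : \int[p]_x (expR (g x))%:E \is a fin_num by rewrite ge0_fin_numE// ltW.
set Z := (\int[p]_x expR (g x))%R.
have ZE : Z%:E = \int[p]_x (expR (g x))%:E by rewrite /Z /Rintegral fineK.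
have Z0 : (0 < Z)%R by rewrite -lte_fin ZE.
under eq_integral do rewrite expRD expRN lnK ?posrE// mulrC EFinM.
rewrite ge0_integralZl//.
- by rewrite -ZE -EFinM mulVf// gt_eqF.
- by apply/measurable_EFinP; exact: measurableT_comp.
- by rewrite lee_fin invr_ge0 ltW.
Qed.

End normalization.

Section sinkhorn.
Context (R : realType) (X Y : ptopologicalType).
Variables (c : X -> Y -> R) (eps : R).
Variables (rho : probability (borel X) R) (nu : probability (borel Y) R).
Hypothesis c_meas : measurable_fun [set: borel X * borel Y]
  (fun z => c z.1 z.2 : R).
Hypothesis eps_gt0 : 0 < eps.
Implicit Types (f : X -> R) (g : Y -> R).

Lemma measurable_eot_exponent f g :
  measurable_fun [set: borel X] f -> measurable_fun [set: borel Y] g ->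
  measurable_fun [set: borel X * borel Y]
    (fun z => - (c z.1 z.2 + f z.1 + g z.2) / eps).
Proof.
move=> mf mg; apply: measurable_funM => //; apply: measurable_funN.
apply: measurable_funD; last exact: measurableT_comp mg _.
by apply: measurable_funD => //; exact: measurableT_comp mf _.
Qed.

Lemma measurable_eot_density f g :
  measurable_fun [set: borel X] f -> measurable_fun [set: borel Y] g ->
  measurable_fun [set: borel X * borel Y] (eot_density c eps f g).
Proof.
by move=> mf mg; apply: measurableT_comp => //; exact: measurable_eot_exponent.
Qed.

Lemma eot_density_gt0 f g z : 0 < eot_density c eps f g z.
Proof. exact: expR_gt0. Qed.

Lemma measurable_sinkhorn_psi_step f : measurable_fun [set: borel X] f ->
  measurable_fun [set: borel Y] (sinkhorn_psi_step c eps rho f).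
Proof.
move=> mf; apply: measurable_funM => //.
apply: (measurableT_comp (@measurable_ln R)).
apply: (measurableT_comp (fine_measurable measurableT)).
apply: (@measurable_fun_fubini_tonelli_G _ _ (borel X) (borel Y) R rho
  (fun z => (expR (- (c z.1 z.2 + f z.1) / eps))%:E)).
  apply/measurable_EFinP; apply: measurableT_comp => //.
  apply: measurable_funM => //; apply: measurable_funN.
  by apply: measurable_funD => //; exact: measurableT_comp mf _.
by move=> z; rewrite lee_fin expR_ge0.
Qed.

Lemma measurable_sinkhorn_phi_step g : measurable_fun [set: borel Y] g ->
  measurable_fun [set: borel X] (sinkhorn_phi_step c eps nu g).
Proof.
move=> mg; apply: measurable_funM => //.
apply: (measurableT_comp (@measurable_ln R)).
apply: (measurableT_comp (fine_measurable measurableT)).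
apply: (@measurable_fun_fubini_tonelli_F _ _ (borel X) (borel Y) R nu
  (fun z => (expR (- (c z.1 z.2 + g z.2) / eps))%:E)).
  apply/measurable_EFinP; apply: measurableT_comp => //.
  apply: measurable_funM => //; apply: measurable_funN.
  by apply: measurable_funD => //; exact: measurableT_comp mg _.
by move=> z; rewrite lee_fin expR_ge0.
Qed.

Lemma measurable_cost_section1 x : measurable_fun [set: borel Y] (c x).
Proof.
have := measurableT_comp c_meas (pair1_measurable (x : borel X)).
exact.
Qed.

Lemma measurable_cost_section2 y : measurable_fun [set: borel X] (c^~ y).
Proof.
have := measurableT_comp c_meas (pair2_measurable (y : borel Y)).
exact.
Qed.

Lemma integral_sinkhorn_psi_step f y : measurable_fun [set: borel X] f ->
  (\int[rho]_x (expR (- (c x y + f x) / eps))%:E < +oo)%E ->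
  (\int[rho]_x (eot_density c eps f (sinkhorn_psi_step c eps rho f) (x, y))%:E
   = 1)%E.
Proof.
move=> mf ilt; rewrite -[RHS](integral_expR_normalized _ ilt).
  apply: eq_integral => x _; congr ((expR _)%:E) => /=.
  by rewrite /sinkhorn_psi_step; set L := ln _; field; rewrite gt_eqF.
apply: measurable_funM => //; apply: measurable_funN.
by apply: measurable_funD => //; exact: measurable_cost_section2.
Qed.

Lemma integral_sinkhorn_phi_step g x : measurable_fun [set: borel Y] g ->
  (\int[nu]_y (expR (- (c x y + g y) / eps))%:E < +oo)%E ->
  (\int[nu]_y (eot_density c eps (sinkhorn_phi_step c eps nu g) g (x, y))%:E
   = 1)%E.
Proof.
move=> mg ilt; rewrite -[RHS](integral_expR_normalized _ ilt).
  apply: eq_integral => y _; congr ((expR _)%:E) => /=.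
  by rewrite /sinkhorn_phi_step; set L := ln _; field; rewrite gt_eqF.
apply: measurable_funM => //; apply: measurable_funN.
by apply: measurable_funD => //; exact: measurable_cost_section1.
Qed.

End sinkhorn.

(** * Plans given by potentials *)

Section plans.
Context (R : realType) (X Y : ptopologicalType).
Variables (c : X -> Y -> R) (eps : R).
Variables (rho : probability (borel X) R) (nu : probability (borel Y) R).
Hypothesis c_meas : measurable_fun [set: borel X * borel Y]
  (fun z => c z.1 z.2 : R).
Hypothesis eps_gt0 : 0 < eps.
Implicit Types (f : X -> R) (g : Y -> R).
Implicit Types (p q : probability (borel X * borel Y)%type R).

Section one_plan.
Variables (p : probability (borel X * borel Y)%type R) (f : X -> R) (g : Y -> R).
Hypothesis mf : measurable_fun [set: borel X] f.
Hypothesis mg : measurable_fun [set: borel Y] g.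
Hypothesis pfg : has_density p (rho \x nu)%E (eot_density c eps f g).
Local Open Scope ereal_scope.

Let mD := measurable_eot_density eps c_meas mf mg.

Let mDE : measurable_fun [set: borel X * borel Y]
  (EFin \o eot_density c eps f g).
Proof. exact/measurable_EFinP. Qed.

Lemma ge0_integral_plan1 (h : borel X -> \bar R) :
  measurable_fun setT h -> (forall x, 0 <= h x) ->
  \int[p]_z h z.1 =
  \int[rho]_x (h x * \int[nu]_y (eot_density c eps f g (x, y))%:E).
Proof.
move=> mh h0.
rewrite (ge0_integral_density mD _ pfg)//; last 2 first.
  by move=> z; exact/ltW/eot_density_gt0.
  exact: measurableT_comp mh _.
rewrite (@fubini_tonelli1 _ _ (borel X) (borel Y) R rho nu
  (fun z => h z.1 * (eot_density c eps f g z)%:E))//.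
- apply: eq_integral => x _; rewrite /fubini_F/= ge0_integralZl//.
  + exact: (measurableT_comp mDE (pair1_measurable (x : borel X))).
  + by move=> y _; rewrite lee_fin ltW// eot_density_gt0.
- by apply: emeasurable_funM => //; exact: measurableT_comp mh _.
- by move=> z; rewrite mule_ge0// lee_fin ltW// eot_density_gt0.
Qed.

Lemma ge0_integral_plan2 (h : borel Y -> \bar R) :
  measurable_fun setT h -> (forall x, 0 <= h x) ->
  \int[p]_z h z.2 =
  \int[nu]_y (h y * \int[rho]_x (eot_density c eps f g (x, y))%:E).
Proof.
move=> mh h0.
rewrite (ge0_integral_density mD _ pfg)//; last 2 first.
  by move=> z; exact/ltW/eot_density_gt0.
  exact: measurableT_comp mh _.
rewrite (@fubini_tonelli2 _ _ (borel X) (borel Y) R rho nu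
  (fun z => h z.2 * (eot_density c eps f g z)%:E))//.
- apply: eq_integral => y _; rewrite /fubini_G/= ge0_integralZl//.
  + exact: (measurableT_comp mDE (pair2_measurable (y : borel Y))).
  + by move=> x _; rewrite lee_fin ltW// eot_density_gt0.
- by apply: emeasurable_funM => //; exact: measurableT_comp mh _.
- by move=> z; rewrite mule_ge0// lee_fin ltW// eot_density_gt0.
Qed.

Lemma integral_plan_mass1 :
  \int[rho]_x \int[nu]_y (eot_density c eps f g (x, y))%:E = 1.
Proof.
have <- : \int[p]_z cst 1 z = 1.
  by rewrite integral_cst// mul1e; exact: probability_setT.
rewrite (@ge0_integral_plan1 (cst 1) (measurable_cst _) (fun=> lee01)).
by apply: eq_integral => x _; rewrite mul1e.
Qed.

Lemma integral_plan_mass2 :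
  \int[nu]_y \int[rho]_x (eot_density c eps f g (x, y))%:E = 1.
Proof.
have <- : \int[p]_z cst 1 z = 1.
  by rewrite integral_cst// mul1e; exact: probability_setT.
rewrite (@ge0_integral_plan2 (cst 1) (measurable_cst _) (fun=> lee01)).
by apply: eq_integral => x _; rewrite mul1e.
Qed.

Lemma coupling_plan_mass2 : couplings rho nu p ->
  {ae nu, forall y, \int[rho]_x (eot_density c eps f g (x, y))%:E = 1}.
Proof.
move=> pc; pose K (y : borel Y) := \int[rho]_x (eot_density c eps f g (x, y))%:E.
have D0 z : 0 <= (eot_density c eps f g z)%:E by rewrite lee_fin expR_ge0.
have K0 y : 0 <= K y by apply: integral_ge0.
have mK : measurable_fun setT K.
  exact: (@measurable_fun_fubini_tonelli_G _ _ (borel X) (borel Y) R rho _ mDE D0).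
have iK : nu.-integrable setT K.
  apply/integrableP; split => //.
  under eq_integral do rewrite gee0_abs//.
  by rewrite integral_plan_mass2 ltry.
have [E _ mE|N [mN N0 sN]] := integral_ae_eq measurableT iK (measurable_cst 1) _.
  have mI : measurable_fun [set: borel Y] (fun y => ((\1_E : borel Y -> R) y)%:E).
    exact/measurable_EFinP/measurable_indic.
  rewrite [LHS]integral_mkcond [RHS]integral_mkcond.
  transitivity (\int[nu]_y (((\1_E : borel Y -> R) y)%:E * K y)).
    apply: eq_integral => y _; rewrite patchE indicE.
    by case: ifPn => yE; rewrite ?mul1e ?mul0e.
  rewrite -(ge0_integral_plan2 mI) => [|y]; last by rewrite lee_fin.
  rewrite (integral_coupling2 pc mI); apply: eq_integral => y _.
  by rewrite patchE indicE; case: ifPn.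
by exists N; split => //; apply: subset_trans sN; apply: subsetC => y /(_ I).
Qed.

End one_plan.

(** The logarithm of the ratio of two densities of plans: a function of [x] plus
    a function of [y], neither of which has to be integrable by itself. *)
Definition log_ratio f g f' g' (z : X * Y) : R :=
  (f' z.1 - f z.1) / eps + (g' z.2 - g z.2) / eps.

Lemma eot_density_ratio f g f' g' z :
  eot_density c eps f g z / eot_density c eps f' g' z
  = expR (log_ratio f g f' g' z).
Proof.
by rewrite -expRN -expRD; congr expR; rewrite /log_ratio; field; rewrite gt_eqF.
Qed.

Section two_plans.
Variables (p q : probability (borel X * borel Y)%type R).
Variables (f f' : X -> R) (g g' : Y -> R).
Hypotheses (mf : measurable_fun [set: borel X] f)
  (mg : measurable_fun [set: borel Y] g)
  (mf' : measurable_fun [set: borel X] f')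
  (mg' : measurable_fun [set: borel Y] g').
Hypothesis pfg : has_density p (rho \x nu)%E (eot_density c eps f g).
Hypothesis qfg : has_density q (rho \x nu)%E (eot_density c eps f' g').

Lemma measurable_log_ratio :
  measurable_fun [set: borel X * borel Y] (log_ratio f g f' g').
Proof.
by apply: measurable_funD; apply: measurable_funM => //;
  apply: measurable_funB; [exact: measurableT_comp mf' _|exact: measurableT_comp mf _
  |exact: measurableT_comp mg' _|exact: measurableT_comp mg _].
Qed.

Lemma rel_entropy_plans :
  rel_entropy p q = (\int[p]_z (log_ratio f g f' g' z)%:E)%E.
Proof.
apply: rel_entropy_expR; first exact: measurable_log_ratio.
have -> : (fun z => expR (log_ratio f g f' g' z)) =
    (fun z => eot_density c eps f g z / eot_density c eps f' g' z).
  by apply/funext => z; rewrite eot_density_ratio.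
apply: has_density_div pfg _ _ qfg; try exact: measurable_eot_density.
- by move=> z; exact/ltW/eot_density_gt0.
- by move=> z; exact/eot_density_gt0.
Qed.

Lemma integral_expRN_log_ratio :
  (\int[p]_z (expR (- log_ratio f g f' g' z))%:E = 1)%E.
Proof.
rewrite (ge0_integral_density (measurable_eot_density eps c_meas mf mg) _ pfg).
- rewrite -(probability_setT q) qfg//; apply: eq_integral => z _.
  rewrite expRN -eot_density_ratio invf_div -EFinM divfK//.
  by rewrite gt_eqF// eot_density_gt0.
- by move=> z; exact/ltW/eot_density_gt0.
- apply/measurable_EFinP; apply: measurableT_comp => //.
  by apply: measurable_funN; exact: measurable_log_ratio.
- by move=> z; rewrite lee_fin expR_ge0.
Qed.

Lemma rel_entropy_plans_ge0 : (0 <= rel_entropy p q)%E.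
Proof.
rewrite rel_entropy_plans; apply: integral_loglik_ge0.
  exact: measurable_log_ratio.
exact: integral_expRN_log_ratio.
Qed.

End two_plans.
End plans.

(** * Entropy along Sinkhorn's iterates *)

(** The iterates are abstract sequences subject to the recursion, which keeps
    them from being unfolded. *)
Section iterates.
Context (R : realType) (X Y : ptopologicalType).
Variables (c : X -> Y -> R) (eps : R).
Variables (rho : probability (borel X) R) (nu : probability (borel Y) R).
Hypothesis c_meas : measurable_fun [set: borel X * borel Y]
  (fun z => c z.1 z.2 : R).
Hypothesis eps_gt0 : 0 < eps.
Variables (phi : nat -> X -> R) (psi : nat -> Y -> R).
Hypothesis phi0_meas : measurable_fun [set: borel X] (phi 0%N).
Hypothesis psiE : forall n, psi n = sinkhorn_psi_step c eps rho (phi n).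
Hypothesis phiS : forall n, phi n.+1 = sinkhorn_phi_step c eps nu (psi n).
Local Notation D n k := (eot_density c eps (phi n) (psi k)).

Hypothesis sinkhorn_int : forall n y,
  rho.-integrable [set: borel X] (fun x =>
    (expR (- (c x y + phi n x) / eps))%:E).
Variable plan : nat -> nat -> probability (borel X * borel Y)%type R.
Hypothesis plan_nn : forall n, has_density (plan n n) (rho \x nu)%E (D n n).
Hypothesis plan_Sn : forall n, has_density (plan n.+1 n) (rho \x nu)%E (D n.+1 n).

Lemma measurable_sinkhorn_phi n : measurable_fun [set: borel X] (phi n).
Proof.
elim: n => // n IH; rewrite phiS psiE; apply: measurable_sinkhorn_phi_step => //.
exact: measurable_sinkhorn_psi_step.
Qed.

Lemma measurable_sinkhorn_psi n : measurable_fun [set: borel Y] (psi n).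
Proof.
by rewrite psiE; apply: measurable_sinkhorn_psi_step => //;
  exact: measurable_sinkhorn_phi.
Qed.

Let mphi := measurable_sinkhorn_phi.
Let mpsi := measurable_sinkhorn_psi.

Lemma sinkhorn_normalized2 n y : (\int[rho]_x (D n n (x, y))%:E = 1)%E.
Proof.
rewrite psiE; apply: (integral_sinkhorn_psi_step c_meas eps_gt0 (mphi n)).
have /integrableP[_] := sinkhorn_int n y; apply: le_lt_trans.
by apply: le_integral_nomeas => x; rewrite gee0_abs// lee_fin expR_ge0.
Qed.

Lemma sinkhorn_normalized1 n :
  {ae rho, forall x, (\int[nu]_y (D n.+1 n (x, y))%:E = 1)%E}.
Proof.
have mDE : measurable_fun [set: borel X * borel Y] (EFin \o D n n).
  by apply/measurable_EFinP; apply: measurable_eot_density.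
have D0 z : (0 <= (D n n z)%:E)%E by rewrite lee_fin expR_ge0.
have : rho.-integrable [set: borel X]
    (fun x => \int[nu]_y (D n n (x, y))%:E)%E.
  apply/integrableP; split.
    exact: (@measurable_fun_fubini_tonelli_F _ _ (borel X) (borel Y) R nu _ mDE D0).
  under eq_integral.
    by move=> x _; rewrite gee0_abs; [over|apply: integral_ge0].
  by rewrite (integral_plan_mass1 c_meas (mphi n) (mpsi n) (plan_nn n)) ltry.
move/(integrable_ae measurableT); apply: filterS => x /(_ I) /=.
rewrite ge0_fin_numE; last by apply: integral_ge0.
move=> xlt.
suff h : (\int[nu]_y (expR (- (c x y + psi n y) / eps))%:E < +oo)%E.
  rewrite phiS; exact: (integral_sinkhorn_phi_step c_meas eps_gt0 (mpsi n) h).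
rewrite [ltLHS](_ : _ =
    \int[nu]_y ((expR (phi n x / eps))%:E * (D n n (x, y))%:E))%E; last first.
  apply: eq_integral => y _; rewrite -EFinM -expRD; congr (expR _)%:E.
  by rewrite /=; lra.
rewrite ge0_integralZl//.
- by rewrite lte_mul_pinfty// lee_fin expR_ge0.
- exact: (measurableT_comp mDE (pair1_measurable (x : borel X))).
Qed.

(** [- phi_drop n] and [- psi_drop n] are the logarithms of the densities of the
    first marginal of [plan n n] with respect to [rho], and of the second
    marginal of [plan n.+1 n] with respect to [nu]. *)
Definition phi_drop n (x : X) : R := (phi n x - phi n.+1 x) / eps.
Definition psi_drop n (y : Y) : R := (psi n y - psi n.+1 y) / eps.

Lemma measurable_phi_drop n : measurable_fun [set: borel X] (phi_drop n).
Proof. by apply: measurable_funM => //; apply: measurable_funB. Qed.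

Lemma measurable_psi_drop n : measurable_fun [set: borel Y] (psi_drop n).
Proof. by apply: measurable_funM => //; apply: measurable_funB. Qed.

Let expRN_phi_dropM n z : expR (- phi_drop n z.1) * D n.+1 n z = D n n z.
Proof.
by rewrite -expRD; congr expR; rewrite /phi_drop; field; rewrite gt_eqF.
Qed.

Let expRN_psi_dropM n z : expR (- psi_drop n z.2) * D n.+1 n.+1 z = D n.+1 n z.
Proof.
by rewrite -expRD; congr expR; rewrite /psi_drop; field; rewrite gt_eqF.
Qed.

Lemma integral_expRN_phi_drop n :
  (\int[rho]_x (expR (- phi_drop n x))%:E = 1)%E.
Proof.
rewrite -(integral_plan_mass1 c_meas (mphi n) (mpsi n) (plan_nn n)).
have mDE a b : measurable_fun [set: borel X * borel Y] (EFin \o D a b).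
  by apply/measurable_EFinP; apply: measurable_eot_density.
have D0 a b z : (0 <= (D a b z)%:E)%E by rewrite lee_fin expR_ge0.
apply: ae_eq_integral => //.
- apply/measurable_EFinP; apply: measurableT_comp => //.
  by apply: measurable_funN; exact: measurable_phi_drop.
- exact: (@measurable_fun_fubini_tonelli_F _ _ (borel X) (borel Y) R nu _
    (mDE n n) (D0 n n)).
- have [N [mN N0 sN]] := sinkhorn_normalized1 n; exists N; split => //.
  apply: subset_trans sN; apply: subsetC => x x1 _.
  transitivity (\int[nu]_y ((expR (- phi_drop n x))%:E * (D n.+1 n (x, y))%:E))%E.
    rewrite ge0_integralZl//.
    + by rewrite x1 mule1.
    + exact: (measurableT_comp (mDE _ _) (pair1_measurable (x : borel X))).
  by apply: eq_integral => y _; rewrite -EFinM (expRN_phi_dropM n (x, y)).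
Qed.

Lemma integral_sinkhorn_psi_drop n y :
  (\int[rho]_x (D n.+1 n (x, y))%:E = (expR (- psi_drop n y))%:E)%E.
Proof.
have mDE a b : measurable_fun [set: borel X * borel Y] (EFin \o D a b).
  by apply/measurable_EFinP; apply: measurable_eot_density.
transitivity (\int[rho]_x ((expR (- psi_drop n y))%:E * (D n.+1 n.+1 (x, y))%:E))%E.
  by apply: eq_integral => x _; rewrite -EFinM (expRN_psi_dropM n (x, y)).
rewrite ge0_integralZl//.
+ by rewrite sinkhorn_normalized2 mule1.
+ exact: (measurableT_comp (mDE _ _) (pair2_measurable (y : borel Y))).
+ by move=> x _; rewrite lee_fin expR_ge0.
Qed.

Lemma integral_expRN_psi_drop n :
  (\int[nu]_y (expR (- psi_drop n y))%:E = 1)%E.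
Proof.
rewrite -(integral_plan_mass2 c_meas (mphi n.+1) (mpsi n) (plan_Sn n)).
by apply: eq_integral => y _; rewrite integral_sinkhorn_psi_drop.
Qed.

Lemma first_marginal_plan n (A : set (borel X)) : measurable A ->
  rho A = plan n.+1 n (fst @^-1` A).
Proof.
move=> mA.
have mDE : measurable_fun [set: borel X * borel Y] (EFin \o D n.+1 n).
  by apply/measurable_EFinP; apply: measurable_eot_density.
have D0 z : (0 <= (D n.+1 n z)%:E)%E by rewrite lee_fin expR_ge0.
have mI : measurable_fun [set: borel X] (fun x => ((\1_A : borel X -> R) x)%:E).
  exact/measurable_EFinP/measurable_indic.
have -> : plan n.+1 n (fst @^-1` A) =
    (\int[plan n.+1 n]_z ((\1_A : borel X -> R) z.1)%:E)%E.
  rewrite (_ : (fun z => _) = (fun z : borel X * borel Y =>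
    (\1_(@fst X Y @^-1` A) z)%:E)) ?integral_indic ?setIT//.
  by rewrite -[X in measurable X]setTI; exact: measurable_fst.
rewrite (ge0_integral_plan1 c_meas (mphi n.+1) (mpsi n) (plan_Sn n) mI); last first.
  by move=> y; rewrite lee_fin.
have -> : rho A = (\int[rho]_x ((\1_A : borel X -> R) x)%:E)%E.
  by rewrite integral_indic// setIT.
apply: ae_eq_integral => //.
- apply: emeasurable_funM => //.
  exact: (@measurable_fun_fubini_tonelli_F _ _ (borel X) (borel Y) R nu _ mDE D0).
- have [N [mN N0 sN]] := sinkhorn_normalized1 n; exists N; split => //.
  by apply: subset_trans sN; apply: subsetC => x x1 _; rewrite x1 mule1.
Qed.

Lemma second_marginal_density n :
  has_density (second_marginal (plan n.+1 n)) nu (fun y => expR (- psi_drop n y)).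
Proof.
move=> A mA.
have -> : second_marginal (plan n.+1 n) A =
    (\int[plan n.+1 n]_z ((\1_A : borel Y -> R) z.2)%:E)%E.
  rewrite (_ : (fun z => _) = (fun z : borel X * borel Y =>
    (\1_(@snd X Y @^-1` A) z)%:E)) ?integral_indic ?setIT//.
  by rewrite -[X in measurable X]setTI; exact: measurable_snd.
rewrite (ge0_integral_plan2 c_meas (mphi n.+1) (mpsi n) (plan_Sn n)
  (h := fun y => ((\1_A : borel Y -> R) y)%:E)).
- rewrite [RHS]integral_mkcond; apply: eq_integral => y _.
  rewrite integral_sinkhorn_psi_drop patchE indicE.
  by case: ifPn => yA; rewrite ?yA ?(negbTE yA) ?mul1e ?mul0e.
- exact/measurable_EFinP/measurable_indic.
- by move=> y; rewrite lee_fin.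
Qed.

(** Under [plan n.+1 n], the conditional law of [x] given [y] has the density
    [D n.+1 n.+1 (-, y)]; hence averaging these laws over the second marginal
    gives back the first one, [rho]. *)
Lemma second_marginal_disintegration n (h : borel X -> \bar R) :
  measurable_fun setT h -> (forall x, 0 <= h x)%E ->
  (\int[second_marginal (plan n.+1 n)]_y
     \int[rho]_x (h x * (D n.+1 n.+1 (x, y))%:E) = \int[rho]_x h x)%E.
Proof.
move=> mh h0.
have mDE k l : measurable_fun [set: borel X * borel Y] (EFin \o D k l).
  by apply/measurable_EFinP; apply: measurable_eot_density.
have mhz : measurable_fun [set: borel X * borel Y] (fun z => h z.1).
  exact: measurableT_comp mh _.
have mhD k l : measurable_fun [set: borel X * borel Y]
    (fun z => h z.1 * (D k l z)%:E)%E by apply: emeasurable_funM => //; exact: mDE.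
have hD0 k l z : (0 <= h z.1 * (D k l z)%:E)%E.
  by rewrite mule_ge0// lee_fin expR_ge0.
have mpsid : measurable_fun [set: borel Y] (fun y => expR (- psi_drop n y)).
  exact: (measurableT_comp (@measurable_expR R)
    (measurable_funN (measurable_psi_drop n))).
rewrite (ge0_integral_density mpsid _ (second_marginal_density n)); last 3 first.
- by move=> y; exact: expR_ge0.
- exact: (@measurable_fun_fubini_tonelli_G _ _ (borel X) (borel Y) R rho _
    (mhD _ _) (hD0 _ _)).
- by move=> y; apply: integral_ge0 => x _; exact: (hD0 _ _ (x, y)).
rewrite -(integral_image (@measurable_fst _ _ (borel X) (borel Y))
  (@first_marginal_plan n) mh).
have md := measurable_eot_density eps c_meas (mphi n.+1) (mpsi n).
rewrite (ge0_integral_density md _ (plan_Sn n))//; last first.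
  by move=> z; exact/ltW/eot_density_gt0.
rewrite (@fubini_tonelli2 _ _ (borel X) (borel Y) R rho nu _ (mhD _ _) (hD0 _ _)).
apply: eq_integral => y _.
transitivity (\int[rho]_x ((expR (- psi_drop n y))%:E *
    (h x * (D n.+1 n.+1 (x, y))%:E)))%E.
  rewrite ge0_integralZl//; first exact: muleC.
  - exact: (measurableT_comp (mhD n.+1 n.+1) (pair2_measurable (y : borel Y))).
  - by move=> x _; exact: (hD0 n.+1 n.+1 (x, y)).
apply: eq_integral => x _.
by rewrite muleCA -EFinM (expRN_psi_dropM n (x, y)).
Qed.

Lemma rel_entropy_nu_marginal n :
  rel_entropy nu (second_marginal (plan n.+1 n)) =
  (\int[nu]_y (psi_drop n y)%:E)%E.
Proof.
apply: rel_entropy_expR; first exact: measurable_psi_drop.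
have -> : (fun y => expR (psi_drop n y)) =
    (fun y => 1 / expR (- psi_drop n y)).
  by apply/funext => y; rewrite expRN invrK mul1r.
apply: (@has_density_div _ _ _ nu _ nu (cst 1)) (second_marginal_density n) => //.
- by move=> A mA; have := integral_cst nu mA 1%E; rewrite mul1e => /esym.
- apply: measurableT_comp => //; apply: measurable_funN.
  exact: measurable_psi_drop.
- by move=> y; exact: expR_gt0.
Qed.

(** The data-processing inequality for the second projection: the density of
    the marginal is an average of the densities [expR (phi_drop n)], and
    [- psi_drop n] is compared with [phi_drop n] by [1 + t <= expR t]. *)
Lemma rel_entropy_marginal_nu_le n :
  (rel_entropy (second_marginal (plan n.+1 n)) nu <=
   \int[rho]_x (phi_drop n x)%:E)%E.
Proof.
have ma := measurable_phi_drop n; have mb := measurable_psi_drop n.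
rewrite (rel_entropy_expR _ (second_marginal_density n)); last exact: measurable_funN.
have m2 : measurable_fun [set: borel Y] (fun y => (- psi_drop n y)%:E).
  exact/measurable_EFinP/measurable_funN.
rewrite -(@integral_image _ _ _ (borel X * borel Y)%type (borel Y)
  (plan n.+1 n) (second_marginal (plan n.+1 n)) snd _ measurable_snd _ m2)//.
have md := measurable_eot_density eps c_meas (mphi n.+1) (mpsi n).
have mDE k l : measurable_fun [set: borel X * borel Y] (EFin \o D k l).
  by apply/measurable_EFinP; apply: measurable_eot_density.
have d0 z : 0 <= D n.+1 n z by exact/ltW/eot_density_gt0.
pose r (z : borel X * borel Y) := phi_drop n z.1 + psi_drop n z.2.
have mr : measurable_fun [set: borel X * borel Y] r.
  by apply: measurable_funD;
    [exact: measurableT_comp ma _|exact: measurableT_comp mb _].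
(* [expR (- psi_drop n z.2) * D n n z] is a probability density *)
have er : (\int[plan n.+1 n]_z (expR (- r z))%:E = 1)%E.
  rewrite (ge0_integral_density md d0 (plan_Sn n)); last 2 first.
  - apply/measurable_EFinP; apply: measurableT_comp => //.
    exact: measurable_funN.
  - by move=> z; rewrite lee_fin expR_ge0.
  pose k z := (expR (- psi_drop n z.2) * D n n z)%:E.
  have mk : measurable_fun [set: borel X * borel Y] k.
    apply/measurable_EFinP; apply: measurable_funM.
      apply: measurableT_comp => //; apply: measurable_funN.
      exact: measurableT_comp mb _.
    by apply: measurable_eot_density.
  have k0 z : (0 <= k z)%E by rewrite lee_fin mulr_ge0 ?expR_ge0.
  transitivity (\int[(rho \x nu)%E]_z k z)%E.
    apply: eq_integral => z _; rewrite -EFinM /k -expRN_phi_dropM mulrA -expRD.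
    by congr ((expR _ * _)%:E); rewrite /r; lra.
  rewrite (@fubini_tonelli2 _ _ (borel X) (borel Y) R rho nu k mk k0).
  rewrite -(integral_expRN_psi_drop n).
  apply: eq_integral => y _; rewrite /fubini_G/k/=.
  under eq_integral do rewrite EFinM.
  rewrite ge0_integralZl//.
  + by rewrite sinkhorn_normalized2 mule1.
  + exact: (measurableT_comp (mDE _ _) (pair2_measurable (y : borel Y))).
  + by move=> x _; rewrite lee_fin expR_ge0.
have ma1 : measurable_fun [set: borel X * borel Y] (fun z => phi_drop n z.1).
  exact: measurableT_comp ma _.
have margE h : measurable_fun [set: borel X] h ->
    (\int[plan n.+1 n]_z h z.1 = \int[rho]_x h x)%E.
  by apply: integral_image => //; exact: first_marginal_plan.
have ea : (\int[plan n.+1 n]_z (expR (- phi_drop n z.1))%:E = 1)%E.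
  rewrite (margE (fun x => (expR (- phi_drop n x))%:E)).
    exact: integral_expRN_phi_drop.
  by apply/measurable_EFinP; apply: measurableT_comp => //; exact: measurable_funN.
have ie : (plan n.+1 n).-integrable setT (fun z => (1 - expR (- r z))%:E).
  by apply: integrable_sub1_expRN => //; rewrite er ltry.
have ie' : (plan n.+1 n).-integrable setT (fun z => (expR (- r z) - 1)%:E).
  have := integrableN ie; apply: eq_integrable => // z _.
  by rewrite /= opprB.
apply: (@le_trans _ _ (\int[plan n.+1 n]_z
    (phi_drop n z.1 + (expR (- r z) - 1))%:E)%E).
  apply: le_integral_nomeas => z; rewrite lee_fin.
  by have := expR_ge1Dx (- r z); rewrite {1}/r; lra.
have ltoo : (\int[plan n.+1 n]_z (expR (- phi_drop n z.1))%:E < +oo)%E.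
  by rewrite ea ltry.
rewrite (@integralD_bounded_below _ _ _ _ _ (fun z => expR (- r z) - 1) _ _ ma1 _
  (integrable_sub1_expRN ma1 ltoo) ie')//.
- rewrite (margE (fun x => (phi_drop n x)%:E)); last exact/measurable_EFinP.
  rewrite [X in (_ + X)%E](_ : _ = 0)%E ?adde0//.
  exact: integral_expRN_sub1.
- apply: measurable_funB => //; apply: measurableT_comp => //.
  exact: measurable_funN.
- by move=> z; have := expR_ge1Dx (- phi_drop n z.1); lra.
Qed.

Section optimal_plan.
Variables (pinu : probability (borel X * borel Y)%type R).
Variables (phinu : X -> R) (psinu : Y -> R).
Hypothesis pinu_coupling : couplings rho nu pinu.
Hypothesis phinu_meas : measurable_fun [set: borel X] phinu.
Hypothesis psinu_meas : measurable_fun [set: borel Y] psinu.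
Hypothesis pinu_dens :
  has_density pinu (rho \x nu)%E (eot_density c eps phinu psinu).

(** Chain rule: [plan n.+1 n] is [plan n n] reweighted by a function of [x] so
    as to have the first marginal [rho], which [pinu] has too. The integral is
    the entropy of [rho] relative to the first marginal of [plan n n]. *)
Lemma rel_entropy_phi_step n :
  rel_entropy pinu (plan n n) =
  (\int[rho]_x (phi_drop n x)%:E + rel_entropy pinu (plan n.+1 n))%E.
Proof.
have ma : measurable_fun [set: borel X] (fun x => (phi_drop n x)%:E).
  by apply/measurable_EFinP; exact: measurable_phi_drop.
have me : measurable_fun [set: borel X] (fun x => (expR (- phi_drop n x))%:E).
  apply/measurable_EFinP; apply: measurableT_comp => //; apply: measurable_funN.
  exact: measurable_phi_drop.
rewrite -(integral_coupling1 pinu_coupling ma).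
rewrite (rel_entropy_plans c_meas eps_gt0 phinu_meas psinu_meas (mphi n) (mpsi n)
  pinu_dens (plan_nn n)).
rewrite (rel_entropy_plans c_meas eps_gt0 phinu_meas psinu_meas (mphi n.+1)
  (mpsi n) pinu_dens (plan_Sn n)).
rewrite -integral_loglikD.
- by apply: eq_integral => z _; congr _%:E; rewrite /log_ratio /phi_drop; lra.
- exact: measurableT_comp (measurable_phi_drop n) _.
- exact: measurable_log_ratio.
- rewrite (integral_coupling1 pinu_coupling me) integral_expRN_phi_drop.
  by rewrite ltry.
- by rewrite (integral_expRN_log_ratio c_meas eps_gt0 phinu_meas psinu_meas
    (mphi n.+1) (mpsi n) pinu_dens (plan_Sn n)) ltry.
Qed.

(** The same chain rule for a reweighting by a function of [y]. *)
Lemma rel_entropy_psi_step n :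
  rel_entropy pinu (plan n.+1 n) =
  (rel_entropy nu (second_marginal (plan n.+1 n))
   + rel_entropy pinu (plan n.+1 n.+1))%E.
Proof.
have mb : measurable_fun [set: borel Y] (fun y => (psi_drop n y)%:E).
  by apply/measurable_EFinP; exact: measurable_psi_drop.
have me : measurable_fun [set: borel Y] (fun y => (expR (- psi_drop n y))%:E).
  apply/measurable_EFinP; apply: measurableT_comp => //; apply: measurable_funN.
  exact: measurable_psi_drop.
rewrite rel_entropy_nu_marginal -(integral_coupling2 pinu_coupling mb).
rewrite (rel_entropy_plans c_meas eps_gt0 phinu_meas psinu_meas (mphi n.+1)
  (mpsi n) pinu_dens (plan_Sn n)).
rewrite (rel_entropy_plans c_meas eps_gt0 phinu_meas psinu_meas (mphi n.+1)
  (mpsi n.+1) pinu_dens (plan_nn n.+1)).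
rewrite -integral_loglikD.
- by apply: eq_integral => z _; congr _%:E; rewrite /log_ratio /psi_drop; lra.
- exact: measurableT_comp (measurable_psi_drop n) _.
- exact: measurable_log_ratio.
- rewrite (integral_coupling2 pinu_coupling me) integral_expRN_psi_drop.
  by rewrite ltry.
- by rewrite (integral_expRN_log_ratio c_meas eps_gt0 phinu_meas psinu_meas
    (mphi n.+1) (mpsi n.+1) pinu_dens (plan_nn n.+1)) ltry.
Qed.

Lemma integral_phi_drop_ge0 n : (0 <= \int[rho]_x (phi_drop n x)%:E)%E.
Proof.
apply: integral_loglik_ge0; first exact: measurable_phi_drop.
exact: integral_expRN_phi_drop.
Qed.

Lemma rel_entropy_nu_marginal_ge0 n :
  (0 <= rel_entropy nu (second_marginal (plan n.+1 n)))%E.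
Proof.
rewrite rel_entropy_nu_marginal.
apply: integral_loglik_ge0; first exact: measurable_psi_drop.
exact: integral_expRN_psi_drop.
Qed.

Lemma rel_entropy_phi_step_le n :
  (rel_entropy pinu (plan n.+1 n) <= rel_entropy pinu (plan n n))%E.
Proof. by rewrite rel_entropy_phi_step leeDr// integral_phi_drop_ge0. Qed.

Lemma rel_entropy_psi_step_le n :
  (rel_entropy pinu (plan n.+1 n.+1) <= rel_entropy pinu (plan n.+1 n))%E.
Proof. by rewrite rel_entropy_psi_step leeDr// rel_entropy_nu_marginal_ge0. Qed.

End optimal_plan.

End iterates.

(** * Integration of the pointwise stability over a coupling *)

Section bounded_functions.
Context d (T : measurableType d) (R : realType) (p : probability T R).
Local Open Scope ereal_scope.

Lemma integralD_bounded (a b : T -> R) (k l : R) :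
  measurable_fun setT a -> measurable_fun setT b ->
  (forall x, - k <= a x)%R -> (forall x, - l <= b x)%R ->
  \int[p]_x (a x + b x)%:E = \int[p]_x (a x)%:E + \int[p]_x (b x)%:E.
Proof.
move=> ma mb ak bl; apply: (integralD_bounded_below ma mb _ _ ak bl);
  exact: finite_measure_integrable_cst.
Qed.

Lemma integralD_cst (a : T -> R) (k l : R) :
  measurable_fun setT a -> (forall x, - k <= a x)%R ->
  \int[p]_x (a x + l)%:E = \int[p]_x (a x)%:E + l%:E.
Proof.
move=> ma ak.
rewrite (@integralD_bounded _ (cst l) k (- l)%R)// => [|x]; last by rewrite opprK.
congr (_ + _); apply: etrans (integral_cst p measurableT l%:E) _.
by apply: etrans (congr1 (mule l%:E) (probability_setT p)) _; rewrite mule1.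
Qed.

End bounded_functions.

(** [q (-, y)] is the density of the conditional law of [x] given [y] for a plan
    with marginals [rho] and [mu]. The hypothesis [stab] is the
    Donsker-Varadhan dual form, over bounded test functions [t], of the bound
    [L * dist z y] on the entropy of the conditional law given [y] relative to
    the conditional law given [z]. *)
Section stability.
Context (R : realType) (X Y : ptopologicalType).
Variables (rho : probability (borel X) R) (nu mu : probability (borel Y) R).
Variable q : X * Y -> R.
Hypothesis q_meas : measurable_fun [set: borel X * borel Y] q.
Hypothesis q_gt0 : forall z, 0 < q z.
Hypothesis q_mass : forall y, (\int[rho]_x (q (x, y))%:E = 1)%E.
Hypothesis mu_marginal : forall h : borel X -> \bar R, measurable_fun setT h ->
  (forall x, 0 <= h x)%E ->
  (\int[mu]_y \int[rho]_x (h x * (q (x, y))%:E) = \int[rho]_x h x)%E.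
Variables (dist : Y -> Y -> R) (L : R).
Hypothesis dist_ge0 : forall y z, 0 <= dist y z.
Hypothesis L_gt0 : 0 < L.
Hypothesis stab : forall (t : X -> R) (k : R), measurable_fun [set: borel X] t ->
  (forall x, `|t x| <= k) -> forall y z,
  \int[rho]_x (t x * q (x, y)) - ln (\int[rho]_x (expR (t x) * q (x, z)))
    <= L * dist z y.

Let mqE : measurable_fun [set: borel X * borel Y] (EFin \o q).
Proof. exact/measurable_EFinP. Qed.

Let mq2 y : measurable_fun [set: borel X] (fun x => q (x, y)).
Proof. exact: (measurableT_comp q_meas (pair2_measurable (y : borel Y))). Qed.

Section bounded_test.
Variables (t : X -> R) (k : R).
Hypothesis mt : measurable_fun [set: borel X] t.
Hypothesis tk : forall x, `|t x| <= k.

Definition cond_mean y : R := \int[rho]_x (t x * q (x, y)).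
Definition cond_mgf z : R := \int[rho]_x (expR (t x) * q (x, z)).

Let tkl x : - k <= t x. Proof. by have := tk x; rewrite ler_norml => /andP[]. Qed.
Let tkr x : t x <= k. Proof. by have := tk x; rewrite ler_norml => /andP[]. Qed.

Let tk0 x : 0 <= t x + k. Proof. by have := tkl x; lra. Qed.

Let cond_mean_shift y :
  (\int[rho]_x ((t x + k)%:E * (q (x, y))%:E) = (cond_mean y + k)%:E)%E.
Proof.
have mtq : measurable_fun [set: borel X] (fun x => t x * q (x, y)).
  exact: measurable_funM.
have iq : rho.-integrable setT (EFin \o (fun x => q (x, y))).
  apply/integrableP; split; first exact/measurable_EFinP.
  under eq_integral do rewrite /= ger0_norm ?ltW//.
  by rewrite q_mass ltry.
have itq : rho.-integrable setT (fun x => (t x * q (x, y))%:E).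
  have : rho.-integrable setT (fun x => k%:E * (q (x, y))%:E)%E by exact: integrableZl.
  apply: le_integrable => //; first exact/measurable_EFinP.
  move=> x _; rewrite -EFinM !abse_EFin lee_fin !normrM ler_pM//.
  by rewrite (le_trans (tk x))// ler_norm.
transitivity (\int[rho]_x ((t x * q (x, y))%:E + (k * q (x, y))%:E))%E.
  by apply: eq_integral => x _; rewrite -EFinM -EFinD mulrDl.
rewrite integralD//; last by have := integrableZl measurableT k iq.
rewrite EFinD; congr (_ + _)%E.
  by rewrite /cond_mean /Rintegral fineK//; exact: integrable_fin_num.
under eq_integral do rewrite EFinM.
rewrite ge0_integralZl//.
- by rewrite q_mass mule1.
- exact/measurable_EFinP.
- by move=> x _; rewrite lee_fin ltW.
- by rewrite lee_fin (le_trans (normr_ge0 _) (tk point)).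
Qed.

Let cond_mgfE z :
  (cond_mgf z)%:E = (\int[rho]_x (expR (t x) * q (x, z))%:E)%E /\
  expR (- k) <= cond_mgf z <= expR k.
Proof.
have me : measurable_fun [set: borel X] (fun x => (expR (t x) * q (x, z))%:E).
  by apply/measurable_EFinP/measurable_funM => //; exact: measurableT_comp.
have cE a : (\int[rho]_x (expR a * q (x, z))%:E = (expR a)%:E)%E.
  under eq_integral do rewrite EFinM.
  rewrite ge0_integralZl//.
  - by rewrite q_mass mule1.
  - exact/measurable_EFinP.
  - by move=> x _; rewrite lee_fin ltW.
have ub : (\int[rho]_x (expR (t x) * q (x, z))%:E <= (expR k)%:E)%E.
  rewrite -(cE k); apply: le_integral_nomeas => x.
  by rewrite lee_fin; apply: ler_wpM2r; [exact: ltW|rewrite ler_expR].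
have lb : ((expR (- k))%:E <= \int[rho]_x (expR (t x) * q (x, z))%:E)%E.
  rewrite -(cE (- k)); apply: le_integral_nomeas => x.
  by rewrite lee_fin; apply: ler_wpM2r; [exact: ltW|rewrite ler_expR].
have fn : (\int[rho]_x (expR (t x) * q (x, z))%:E)%E \is a fin_num.
  rewrite ge0_fin_numE ?(le_lt_trans ub) ?ltry//.
  by apply: integral_ge0 => x _; rewrite lee_fin mulr_ge0 ?expR_ge0 ?ltW.
have e : (cond_mgf z)%:E = (\int[rho]_x (expR (t x) * q (x, z))%:E)%E.
  by rewrite /cond_mgf /Rintegral fineK.
by split=> //; rewrite -!lee_fin e ub lb.
Qed.

Lemma cond_mgf_gt0 z : 0 < cond_mgf z.
Proof. by have [_ /andP[+ _]] := cond_mgfE z; apply: lt_le_trans; rewrite expR_gt0. Qed.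

Lemma EFin_cond_mgf z :
  (cond_mgf z)%:E = (\int[rho]_x (expR (t x) * q (x, z))%:E)%E.
Proof. by have [] := cond_mgfE z. Qed.

Lemma ln_cond_mgf_bounds z : - k <= ln (cond_mgf z) <= k.
Proof.
have [_ /andP[lb ub]] := cond_mgfE z.
apply/andP; split.
  by rewrite -[leLHS](expRK (- k)) ler_ln ?posrE ?expR_gt0 ?cond_mgf_gt0.
by rewrite -[leRHS](expRK k) ler_ln ?posrE ?expR_gt0 ?cond_mgf_gt0.
Qed.

Lemma measurable_cond_mgf : measurable_fun [set: borel Y] cond_mgf.
Proof.
apply: (measurableT_comp (fine_measurable measurableT)).
apply: (@measurable_fun_fubini_tonelli_G _ _ (borel X) (borel Y) R rho
  (fun z => (expR (t z.1) * q z)%:E)).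
  apply/measurable_EFinP; apply: measurable_funM => //.
  by apply: measurableT_comp => //; exact: measurableT_comp mt _.
by move=> z; rewrite lee_fin mulr_ge0 ?expR_ge0 ?ltW.
Qed.

Let mshift : measurable_fun [set: borel Y]
  (fun y => \int[rho]_x ((t x + k)%:E * (q (x, y))%:E))%E.
Proof.
apply: (@measurable_fun_fubini_tonelli_G _ _ (borel X) (borel Y) R rho
  (fun z => ((t z.1 + k)%:E * (q z)%:E)%E)).
  apply: emeasurable_funM; last exact: mqE.
  apply/measurable_EFinP; apply: measurable_funD => //.
  exact: measurableT_comp mt _.
by move=> z; rewrite -EFinM lee_fin; apply: mulr_ge0; [exact: tk0|exact: ltW].
Qed.

Lemma cond_mean_lb y : - k <= cond_mean y.
Proof.
rewrite -subr_ge0 opprK -lee_fin -cond_mean_shift.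
apply: integral_ge0 => x _.
by rewrite -EFinM lee_fin; apply: mulr_ge0; [exact: tk0|exact: ltW].
Qed.

Lemma measurable_cond_mean : measurable_fun [set: borel Y] cond_mean.
Proof.
rewrite (_ : cond_mean = (fun y =>
    fine (\int[rho]_x ((t x + k)%:E * (q (x, y))%:E))%E - k)); last first.
  by apply/funext => y; rewrite cond_mean_shift/= addrK.
apply: measurable_funB => //.
exact: (measurableT_comp (fine_measurable measurableT) mshift).
Qed.

Lemma integral_cond_mean :
  (\int[mu]_y (cond_mean y)%:E = \int[rho]_x (t x)%:E)%E.
Proof.
have h : (\int[mu]_y (cond_mean y + k)%:E = \int[rho]_x (t x + k)%:E)%E.
  under eq_integral do rewrite -cond_mean_shift.
  apply: (mu_marginal (h := fun x => (t x + k)%:E)) => [|x].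
    by apply/measurable_EFinP; exact: measurable_funD.
  by rewrite lee_fin.
move: h; rewrite (integralD_cst _ _ measurable_cond_mean cond_mean_lb).
rewrite (integralD_cst _ _ mt tkl).
have addIk (a b : \bar R) : (a + k%:E = b + k%:E -> a = b)%E.
  by move: a b => [a| |] [b| |] //= [] /addIr ->.
exact: addIk.
Qed.

Context dG (G : measurableType dG) (gam : probability G R).
Variables (zf yf : G -> borel Y).
Hypotheses (mzf : measurable_fun setT zf) (myf : measurable_fun setT yf).
Hypothesis zf_law : forall A, measurable A -> nu A = gam (zf @^-1` A).
Hypothesis yf_law : forall A, measurable A -> mu A = gam (yf @^-1` A).

(** [zf] and [yf] are the two coordinates of a coupling of [nu] and [mu], in
    either order. *)
Lemma bounded_stability :
  (\int[rho]_x (t x)%:E + \int[nu]_z (- ln (cond_mgf z))%:E <=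
   L%:E * \int[gam]_s (dist (zf s) (yf s))%:E)%E.
Proof.
have ml : measurable_fun [set: borel Y] (fun z => - ln (cond_mgf z)).
  apply: measurable_funN; apply: (measurableT_comp (@measurable_ln R)).
  exact: measurable_cond_mgf.
have mlz := measurableT_comp ml mzf.
have mmy := measurableT_comp measurable_cond_mean myf.
rewrite -integral_cond_mean.
rewrite -(integral_image mzf zf_law (h := fun z : borel Y => (- ln (cond_mgf z))%:E));
  last exact/measurable_EFinP.
rewrite -(integral_image myf yf_law (h := fun z : borel Y => (cond_mean z)%:E));
  last by apply/measurable_EFinP; exact: measurable_cond_mean.
have lbm s : - k <= (cond_mean \o yf) s by exact: cond_mean_lb.
have lbl s : - k <= ((fun z => - ln (cond_mgf z)) \o zf) s.
  by rewrite /= lerN2; have /andP[] := ln_cond_mgf_bounds (zf s).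
rewrite -(integralD_bounded gam mmy mlz lbm lbl).
set h := fun s => cond_mean (yf s) - ln (cond_mgf (zf s)).
have mh : measurable_fun setT h by exact: measurable_funD.
(* [dist] may fail to be measurable, so the factor [L] is moved to [h] *)
have mhp : measurable_fun setT (fun s => Num.max (h s) 0 / L).
  by apply: measurable_funM => //; exact: measurable_maxr.
apply: (@le_trans _ _ (L%:E * \int[gam]_s (Num.max (h s) 0 / L)%:E)%E).
  rewrite -ge0_integralZl//; last 3 first.
  - exact/measurable_EFinP.
  - by move=> s _; rewrite lee_fin divr_ge0 ?le_max ?lexx ?orbT// ltW.
  - by rewrite lee_fin ltW.
  apply: le_integral_nomeas => s.
  by rewrite -EFinM mulrCA mulfV ?gt_eqF// mulr1 lee_fin le_max lexx.
apply: lee_wpmul2l; first by rewrite lee_fin ltW.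
apply: le_integral_nomeas => s; rewrite lee_fin ler_pdivrMr// mulrC.
rewrite ge_max mulr_ge0 ?(ltW L_gt0)// andbT.
exact: (stab mt tk).
Qed.

End bounded_test.

End stability.

(** * Removal of the truncation *)

Section truncation.
Context (R : realType).
Implicit Types u v k : R.

Definition trunc k u : R := Num.max (Num.min u k) (- k).

(** If [expR u] has the mean [expR (- v)] under a probability measure, then the
    mean of [expR (trunc k u)] is at most [expR (- v) + expR (- k)] and, for
    [0 <= k], at most [expR k]; the negative of its logarithm is therefore at
    least [ln_trunc k v]. *)
Definition ln_trunc k v : R := Num.max (- ln (expR (- v) + expR (- k))) (- k).

Lemma trunc_bound k u : 0 <= k -> `|trunc k u| <= k.
Proof.
by move=> k0; rewrite /trunc ler_norml; case: (leP u k) => ?;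
  [case: (leP u (- k))|case: (leP k (- k))] => ?; apply/andP; split; lra.
Qed.

Lemma expR_trunc_le k u : expR (trunc k u) <= expR u + expR (- k).
Proof.
rewrite /trunc; case: (leP (Num.min u k) (- k)) => _.
  by rewrite lerDr expR_ge0.
by rewrite ler_wpDr ?expR_ge0// ler_expR ge_min lexx.
Qed.

Let ln_addexp_le k v :
  ln (expR (- v) + expR (- k)) <= ln 2 - Num.min v k.
Proof.
rewrite -[leRHS]expRK expRB lnK ?posrE// ler_ln ?posrE; last 2 first.
- by rewrite addr_gt0 ?expR_gt0.
- by rewrite divr_gt0 ?expR_gt0.
rewrite -expRN mulr_natl mulr2n.
by apply: lerD; rewrite ler_expR lerN2 ge_min lexx ?orbT.
Qed.

Lemma ln_trunc_ge k v : trunc k v - ln 2 <= ln_trunc k v.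
Proof.
have lnE := ln_addexp_le k v.
have l2 : 0 <= ln 2 :> R by rewrite ln_ge0// ler1n.
rewrite /trunc /ln_trunc; move: lnE; set a := ln (_ + _); set m := Num.min v k.
by case: (leP m (- k)) => ?; case: (leP (- a) (- k)) => ? ?; lra.
Qed.

Lemma ln_trunc_lb k v : - k <= ln_trunc k v.
Proof. by rewrite /ln_trunc le_max lexx orbT. Qed.

Lemma truncD_ge k u v : 0 <= k -> Num.min 0 (u + v) <= trunc k u + trunc k v.
Proof.
by move=> k0; rewrite /trunc; case: (leP 0 (u + v)) => ?; case: (leP u k) => ?;
  case: (leP v k) => ?; rewrite ?maxEle; repeat case: ifPn; rewrite -?ltNge => *; lra.
Qed.

(** A lower bound uniform in [k]: [trunc k] is odd, monotone and 1-Lipschitz,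
    so that [trunc k u + trunc k v] lies between [0] and [u + v], while
    [ln_trunc] is at least [trunc] up to [ln 2]. The term [expR (- (u + v))],
    which is integrable in the application, absorbs the negative part. *)
Lemma ln_truncD_ge k u v : 0 <= k ->
  0 <= trunc k u + ln_trunc k v + expR (- (u + v)) + ln 2.
Proof.
move=> k0; have := truncD_ge u v k0; have := ln_trunc_ge k v.
have := expR_ge0 (- (u + v)); have := expR_ge1Dx (- (u + v)).
by case: (leP 0 (u + v)) => ? ? ? ? ?; lra.
Qed.

Lemma cvg_trunc u : trunc n%:R u @[n --> \oo] --> u.
Proof.
apply: cvg_near_cst; near=> n.
have : `|u| <= n%:R by near: n; exact: nbhs_infty_ger.
rewrite ler_norml => /andP[lu uu].
by rewrite /trunc (min_idPl uu) (max_idPl lu).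
Unshelve. all: by end_near. Qed.

Lemma cvg_ln_trunc v : ln_trunc n%:R v @[n --> \oo] --> v.
Proof.
have : - ln (expR (- v) + expR (- n%:R)) @[n --> \oo] --> v.
  rewrite -[X in _ --> X]opprK; apply: cvgN.
  rewrite -[X in _ --> X]expRK; apply: continuous_cvg.
    by apply: continuous_ln; exact: expR_gt0.
  rewrite -[X in _ --> X]addr0; apply: cvgD; first exact: cvg_cst.
  exact: cvgn_expR.
apply: cvg_trans; apply: near_eq_cvg; near=> n.
have : `|v| + ln 2 <= n%:R by near: n; exact: nbhs_infty_ger.
move=> vn; have := ln_addexp_le n%:R v; rewrite /ln_trunc.
have l2 : 0 <= ln 2 :> R by rewrite ln_ge0// ler1n.
have v1 : v <= n%:R by have := ler_norm v; lra.
have v2 : - n%:R + ln 2 <= v by have := lerNnormlW (lexx `|v|); lra.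
rewrite (min_idPl v1) => lnE.
by rewrite (max_idPl (_ : - n%:R <= - ln (expR (- v) + expR (- n%:R))))//; lra.
Unshelve. all: by end_near. Qed.

End truncation.

Section limit.
Context (R : realType) (X Y : ptopologicalType).
Variables (rho : probability (borel X) R) (nu mu : probability (borel Y) R).
Variable q : X * Y -> R.
Hypothesis q_meas : measurable_fun [set: borel X * borel Y] q.
Hypothesis q_gt0 : forall z, 0 < q z.
Hypothesis q_mass : forall y, (\int[rho]_x (q (x, y))%:E = 1)%E.
Hypothesis mu_marginal : forall h : borel X -> \bar R, measurable_fun setT h ->
  (forall x, 0 <= h x)%E ->
  (\int[mu]_y \int[rho]_x (h x * (q (x, y))%:E) = \int[rho]_x h x)%E.
Variables (dist : Y -> Y -> R) (L : R).
Hypothesis dist_ge0 : forall y z, 0 <= dist y z.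
Hypothesis L_gt0 : 0 < L.
Hypothesis stab : forall (t : X -> R) (k : R), measurable_fun [set: borel X] t ->
  (forall x, `|t x| <= k) -> forall y z,
  \int[rho]_x (t x * q (x, y)) - ln (\int[rho]_x (expR (t x) * q (x, z)))
    <= L * dist z y.

Variables (pinu : probability (borel X * borel Y)%type R).
Hypothesis pinu_coupling : couplings rho nu pinu.
Variables (U : X -> R) (V : Y -> R).
Hypothesis mU : measurable_fun [set: borel X] U.
Hypothesis mV : measurable_fun [set: borel Y] V.
Hypothesis mgf_UV : {ae nu, forall y,
  (\int[rho]_x (expR (U x) * q (x, y))%:E = (expR (- V y))%:E)%E}.
Hypothesis expRN_UV : (\int[pinu]_z (expR (- (U z.1 + V z.2)))%:E = 1)%E.

Context dG (G : measurableType dG) (gam : probability G R).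
Variables (zf yf : G -> borel Y).
Hypotheses (mzf : measurable_fun setT zf) (myf : measurable_fun setT yf).
Hypothesis zf_law : forall A, measurable A -> nu A = gam (zf @^-1` A).
Hypothesis yf_law : forall A, measurable A -> mu A = gam (yf @^-1` A).

Let transport : \bar R := (L%:E * \int[gam]_s (dist (zf s) (yf s))%:E)%E.

Let Uk (n : nat) x := trunc n%:R (U x).
Let Vk (n : nat) y := ln_trunc n%:R (V y).

Let mUk n : measurable_fun [set: borel X] (Uk n).
Proof. by apply: measurable_maxr => //; exact: measurable_minr. Qed.

Let mVk n : measurable_fun [set: borel Y] (Vk n).
Proof.
apply: measurable_maxr => //; apply: measurable_funN.
apply: (measurableT_comp (@measurable_ln R)); apply: measurable_funD => //.
by apply: measurableT_comp => //; exact: measurable_funN.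
Qed.

Let mq2 y : measurable_fun [set: borel X] (fun x => q (x, y)).
Proof. exact: (measurableT_comp q_meas (pair2_measurable (y : borel Y))). Qed.

Let Uk_bound n x : `|Uk n x| <= n%:R.
Proof. exact: trunc_bound. Qed.

Let Vk_lb n y : - n%:R <= Vk n y.
Proof. exact: ln_trunc_lb. Qed.

Let Vk_le n : {ae nu, forall y, Vk n y <= - ln (cond_mgf rho q (Uk n) y)}.
Proof.
have [N [mN N0 sN]] := mgf_UV; exists N; split => //.
apply: subset_trans sN; apply: subsetC => y ey.
have c0 := cond_mgf_gt0 q_meas q_gt0 q_mass (mUk n) (Uk_bound n) y.
have /andP[_ cb] := ln_cond_mgf_bounds q_meas q_gt0 q_mass (mUk n) (Uk_bound n) y.
rewrite /= /Vk /ln_trunc ge_max !lerN2 cb andbT ler_ln ?posrE ?addr_gt0 ?expR_gt0//.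
rewrite -lee_fin (EFin_cond_mgf q_meas q_gt0 q_mass (mUk n) (Uk_bound n)) EFinD -ey.
have -> : (expR (- n%:R))%:E = (\int[rho]_x (expR (- n%:R) * q (x, y))%:E)%E.
  under eq_integral do rewrite EFinM.
  rewrite ge0_integralZl//.
  - by rewrite q_mass mule1.
  - exact/measurable_EFinP.
  - by move=> x _; rewrite lee_fin ltW.
rewrite -ge0_integralD//.
- apply: le_integral_nomeas => x; rewrite -EFinD lee_fin -mulrDl.
  by apply: ler_wpM2r; [exact: ltW|exact: expR_trunc_le].
- by move=> x _; rewrite lee_fin mulr_ge0 ?expR_ge0 ?ltW.
- by apply/measurable_EFinP/measurable_funM => //; exact: measurableT_comp.
- by move=> x _; rewrite lee_fin mulr_ge0 ?expR_ge0 ?ltW.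
- by apply/measurable_EFinP/measurable_funM.
Qed.

Let truncated_le n :
  (\int[pinu]_z (Uk n z.1 + Vk n z.2)%:E <= transport)%E.
Proof.
have mUE : measurable_fun [set: borel X] (fun x => (Uk n x)%:E).
  exact/measurable_EFinP.
have mVE : measurable_fun [set: borel Y] (fun x => (Vk n x)%:E).
  exact/measurable_EFinP.
have Uk_lb x : - n%:R <= Uk n x.
  by have := Uk_bound n x; rewrite ler_norml => /andP[].
have ml : measurable_fun [set: borel Y] (fun z => - ln (cond_mgf rho q (Uk n) z)).
  apply: measurable_funN; apply: (measurableT_comp (@measurable_ln R)).
  exact: measurable_cond_mgf.
have l_lb z : - n%:R <= - ln (cond_mgf rho q (Uk n) z).
  have /andP[_ cb] := ln_cond_mgf_bounds q_meas q_gt0 q_mass (mUk n) (Uk_bound n) z.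
  by rewrite lerN2.
rewrite (@integralD_bounded _ _ _ pinu (fun z => Uk n z.1) (fun z => Vk n z.2)
  n%:R n%:R)//; last 2 first.
- exact: measurableT_comp (mUk n) _.
- exact: measurableT_comp (mVk n) _.
rewrite (integral_coupling1 pinu_coupling mUE) (integral_coupling2 pinu_coupling mVE).
have h := bounded_stability q_meas q_gt0 q_mass mu_marginal dist_ge0 L_gt0 stab
  (mUk n) (Uk_bound n) mzf myf zf_law yf_law.
apply: le_trans h; apply: leeD2l.
suff : (\int[nu]_y (Vk n y + n%:R)%:E <=
        \int[nu]_z (- ln (cond_mgf rho q (Uk n) z) + n%:R)%:E)%E.
  rewrite (integralD_cst _ _ (mVk n) (Vk_lb n)) (integralD_cst _ _ ml l_lb).
  by rewrite leeD2rE.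
apply: ae_ge0_le_integral => //.
- by move=> y _; rewrite lee_fin; have := Vk_lb n y; lra.
- by apply/measurable_EFinP; exact: measurable_funD.
- by move=> y _; rewrite lee_fin; have := l_lb y; lra.
- by apply/measurable_EFinP; exact: measurable_funD.
- have [N [mN N0 sN]] := Vk_le n; exists N; split => //.
  by apply: subset_trans sN; apply: subsetC => y hy _; rewrite lee_fin lerD2r.
Qed.

(** The test function [trunc n U] is bounded, and Fatou's lemma yields the limit;
    [U z.1 + V z.2] is the optimal Donsker-Varadhan functional. Truncating [U]
    avoids the integrability of [U] and [V] taken separately, which may fail
    even if their sum is integrable. *)
Lemma integral_le_transport :
  (\int[pinu]_z (U z.1 + V z.2)%:E <= transport)%E.
Proof.
pose s z := U z.1 + V z.2.
have ms : measurable_fun [set: borel X * borel Y] s.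
  by apply: measurable_funD;
    [exact: measurableT_comp mU _|exact: measurableT_comp mV _].
have me : measurable_fun [set: borel X * borel Y] (fun z => expR (- s z)).
  by apply: measurableT_comp => //; exact: measurable_funN.
pose r z := expR (- s z) + ln 2.
have mr : measurable_fun [set: borel X * borel Y] r by exact: measurable_funD.
have l2 : 0 <= ln 2 :> R by rewrite ln_ge0// ler1n.
have r0 z : - 0 <= r z by rewrite oppr0 addr_ge0 ?expR_ge0.
have rE : (\int[pinu]_z (r z)%:E = (1 + ln 2)%:E)%E.
  rewrite (@integralD_cst _ _ _ pinu _ 0)//; last first.
    by move=> z; rewrite oppr0 expR_ge0.
  by rewrite expRN_UV.
pose w n z := Uk n z.1 + Vk n z.2.
have mw n : measurable_fun [set: borel X * borel Y] (w n).
  by apply: measurable_funD;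
    [exact: measurableT_comp (mUk n) _|exact: measurableT_comp (mVk n) _].
have wlb n z : - (n%:R *+ 2) <= w n z.
  have := Vk_lb n z.2; have := Uk_bound n z.1; rewrite ler_norml => /andP[].
  by rewrite /w mulr2n; lra.
have wr_ge0 n z : 0 <= w n z + r z.
  have := @ln_truncD_ge _ n%:R (U z.1) (V z.2) (ler0n _ _).
  by rewrite /w /r /s /Uk /Vk addrA.
have cvg_wr z : (w n z + r z)%:E @[n --> \oo] --> (s z + r z)%:E.
  apply: cvg_EFin; first by near=> n.
  by apply: cvgD; [apply: cvgD; [exact: cvg_trunc|exact: cvg_ln_trunc]|exact: cvg_cst].
have wrE n : (\int[pinu]_z (w n z + r z)%:E <= transport + (1 + ln 2)%:E)%E.
  rewrite (integralD_bounded pinu (mw n) mr (wlb n) r0) rE.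
  by rewrite leeD2r// truncated_le.
have : (\int[pinu]_z (s z + r z)%:E <= transport + (1 + ln 2)%:E)%E.
  have mwr n : measurable_fun [set: borel X * borel Y] (fun z => (w n z + r z)%:E).
    by apply/measurable_EFinP; exact: measurable_funD.
  have := @fatou _ _ _ pinu _ measurableT (fun n z => (w n z + r z)%:E) mwr
    (fun n z _ => wr_ge0 n z).
  under eq_integral do rewrite (is_cvg_limn_einfE (cvgP _ (cvg_wr _)))
    (cvg_lim _ (cvg_wr _))//.
  move=> /le_trans; apply; rewrite limn_einf_lim.
  apply: lime_le; first exact: is_cvg_einfs.
  apply: nearW => n; apply: le_trans (wrE n).
  by apply: ereal_inf_lbound; exists n => /=.
have ltoo : (\int[pinu]_z (expR (- s z))%:E < +oo)%E by rewrite expRN_UV ltry.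
have sub1 z : 1 - expR (- s z) <= s z by have := expR_ge1Dx (- s z); lra.
rewrite (integralD_bounded_below ms mr (integrable_sub1_expRN ms ltoo)
  (finite_measure_integrable_cst pinu (- 0) measurableT) sub1 r0).
by rewrite rE leeD2rE.
Unshelve. all: by end_near. Qed.

End limit.

(** * The support carries the measure *)

Section support.
Context (R : realType) (X : completePseudoMetricType R).
Variable rho : probability (borel X) R.

(** The complement of the support is covered by the negligible balls of
    radius [1 / n] centred on a countable dense set. *)
Lemma supp_ae : polish X -> {ae rho, forall x, supp rho x}.
Proof.
move=> [_ [S [cS dS]]].
pose B (s : X) (k : nat) : set X := (ball s k.+1%:R^-1)°.
have oB s k : open (B s k) by exact: open_interior.
have mB s k : measurable (B s k : set (borel X)) by exact: sub_sigma_algebra.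
pose N s k : set (borel X) := if rho (B s k) == 0%E then B s k else set0.
have N0 s k : rho.-negligible (N s k).
  rewrite /N; case: eqP => [B0|_]; last exact: negligible_set0.
  by exists (B s k); split.
have [S0|[f]] := pfcard_geP cS.
  have : (setT `&` S) !=set0 by apply: dS; [exists point|exact: openT].
  by rewrite S0 setI0 => -[].
have : rho.-negligible (\bigcup_i \bigcup_k N (f i) k).
  by apply: negligible_bigcup => i; exact: negligible_bigcup.
apply: negligibleS => x /= xN.
have [U [oU Ux U0]] : exists U : set X, [/\ open U, U x & rho U = 0%E].
  move: xN => /existsNP[U /not_implyP[oU /not_implyP[Ux U0]]]; exists U.
  by split=> //; apply/eqP; rewrite eq_le measure_ge0 andbT leNgt; exact/negP.
have [e /= e0 xeU] : nbhs_ball x U by apply/nbhs_ballP; exact: open_nbhs_nbhs.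
have [k ke] : exists k, k.+1%:R^-1 < e / 2.
  exists (Num.truncn (e / 2)^-1); rewrite invf_plt ?posrE ?divr_gt0//.
  by rewrite truncnS_gt.
set r := k.+1%:R^-1 in ke.
have r0 : 0 < r by rewrite invr_gt0.
have [s [xs Ss]] : (ball x (r / 2))° `&` S !=set0.
  apply: dS; last exact: open_interior.
  by exists x; apply: nbhsx_ballx; rewrite divr_gt0.
have {}xs := interior_subset xs.
have [i _ fis] : (f @` setT) s by exact: (@surj _ _ _ _ f).
exists i => //; exists k => //; rewrite fis /N.
have BU : B s k `<=` U.
  move=> y /interior_subset sy; apply: xeU.
  apply: le_ball (ball_triangle xs sy); rewrite -/r; lra.
suff Bs0 : rho (B s k) = 0%E.
  rewrite Bs0 eqxx; apply: filterS (nbhsx_ballx x (r / 2) _); last by rewrite divr_gt0.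
  move=> y xy; rewrite (_ : k.+1%:R^-1 = r / 2 + r / 2); last by rewrite -splitr.
  exact: ball_triangle (ball_sym xs) xy.
apply/eqP; rewrite eq_le measure_ge0 andbT -U0; apply: le_measure => //;
  rewrite inE; first exact: mB.
by apply: sub_sigma_algebra.
Qed.

End support.

(** * Pointwise stability from semiconcavity *)

Section semiconcave_plan.
Context (R : realType) (X : completePseudoMetricType R).
Context (m : nat) (Y : ptopologicalType) (M : riemannian_manifold R m Y).

Lemma riem_innerE (y : Y) (u v : 'rV[R]_m) :
  riem_inner M y u v =
  \sum_i u 0 i * (gram M y (chart M y y) *m v^T) i 0.
Proof. by rewrite /riem_inner -mulmxA mxE. Qed.

Lemma mgradD (f g : Y -> R) y : mdifferentiable M f y -> mdifferentiable M g y ->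
  mgrad M (fun y => f y + g y) y = mgrad M f y + mgrad M g y.
Proof.
move=> df dg; rewrite /mgrad -mulmxDl; congr (_ *m _).
apply/rowP => i; rewrite !mxE.
have := deriveD (@diff_derivable _ _ _ _ _ (delta_mx 0 i) df)
  (@diff_derivable _ _ _ _ _ (delta_mx 0 i) dg).
by [].
Qed.

Lemma C1_fun_mdifferentiable (f : Y -> R) y : C1_fun M f -> mdifferentiable M f y.
Proof.
move=> /(_ y) [+ _]; apply; exists y => //; exact: chart_dom_center.
Qed.

Variable rho : probability (borel X) R.
Variables (c : X -> Y -> R) (eps : R) (f : X -> R) (g : Y -> R).
Hypothesis eps_gt0 : 0 < eps.
Hypothesis supp_rho : {ae rho, forall x, supp rho x}.
Local Notation q := (eot_density c eps f g).
Hypothesis q_meas : forall y, measurable_fun [set: borel X] (fun x => q (x, y)).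
Hypothesis q_mass : forall y, (\int[rho]_x (q (x, y))%:E = 1)%E.
Hypothesis c_diff : forall x y, mdifferentiable M (c x) y.
Hypothesis g_diff : forall y, mdifferentiable M g y.
Hypothesis g_grad : forall y i,
  rho.-integrable [set: borel X] (fun x => (mgrad M (c x) y 0 i * q (x, y))%:E) /\
  mgrad M g y 0 i = - \int[rho]_x (mgrad M (c x) y 0 i * q (x, y)).
Variable Lambda : R.
Hypothesis sc : forall x, supp rho x ->
  semiconcave M Lambda (fun y => c x y + g y).
Hypothesis Y_geodesic : forall y z : Y,
  exists h, [/\ geodesic M h, h 0 = y & h 1 = z].

(** The gradient of [c x + g] at [y] has mean zero under [q (-, y)], so that the
    semiconcavity inequality loses its linear term when it is averaged. *)
Lemma integral_inner_mgrad y (v : 'rV[R]_m) :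
  let s x := riem_inner M y (mgrad M (fun y => c x y + g y) y) v in
  rho.-integrable [set: borel X] (fun x => (s x * q (x, y))%:E) /\
  (\int[rho]_x (s x * q (x, y))%:E = 0)%E.
Proof.
pose w i := (gram M y (chart M y y) *m v^T) i 0.
have q0 x : 0 <= q (x, y) by exact: expR_ge0.
have iq : rho.-integrable [set: borel X] (fun x => (q (x, y))%:E).
  apply/integrableP; split; first exact/measurable_EFinP.
  under eq_integral do rewrite gee0_abs ?lee_fin//.
  by rewrite q_mass ltry.
pose F i (x : X) : \bar R := ((w i)%:E * ((mgrad M (c x) y 0 i * q (x, y))%:E +
  (mgrad M g y 0 i)%:E * (q (x, y))%:E))%E.
have iF1 i : rho.-integrable [set: borel X] (fun x =>
    (mgrad M (c x) y 0 i * q (x, y))%:E + (mgrad M g y 0 i)%:E * (q (x, y))%:E)%E.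
  by apply: integrableD => //; [have [] := g_grad y i|exact: integrableZl].
have iF i : rho.-integrable [set: borel X] (F i) by exact: integrableZl.
have sF x : ((riem_inner M y (mgrad M (fun y => c x y + g y) y) v) * q (x, y))%:E
    = (\sum_(i < m) F i x)%E.
  rewrite mgradD// riem_innerE mulr_suml -sumEFin; apply: eq_bigr => i _.
  transitivity (w i * (mgrad M (c x) y 0 i * q (x, y) +
    mgrad M g y 0 i * q (x, y)))%:E; last by [].
  by congr EFin; rewrite mxE -/(w i); ring.
rewrite /=; split.
  rewrite (_ : (fun x => _) = (fun x => \sum_(i < m) F i x)%E); last exact/funext.
  exact: integrable_sum.
under eq_integral do rewrite sF.
rewrite integral_sum//= big1// => i _.
rewrite integralZl// integralD//=; [|by have [] := g_grad y i|exact: integrableZl].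
rewrite integralZl// q_mass mule1 (g_grad y i).2.
rewrite EFinN /Rintegral fineK; last first.
  by apply: integrable_fin_num => //; have [] := g_grad y i.
rewrite subee ?mule0//.
by apply: integrable_fin_num => //; have [] := g_grad y i.
Qed.

(** The ratio [q (x, z) / q (x, y)] is [expR (- F x / eps)], where [F x] is the
    increment of [c x + g] from [y] to [z]; semiconcavity bounds [F] from above
    and Jensen's inequality for [expR] under [q (-, y)] concludes, as the linear
    term has mean zero. *)
Lemma semiconcave_stability (t : X -> R) (k : R) :
  measurable_fun [set: borel X] t -> (forall x, `|t x| <= k) -> forall y z,
  \int[rho]_x (t x * q (x, y)) - ln (\int[rho]_x (expR (t x) * q (x, z)))
    <= Lambda / (2 * eps) * riem_dist M z y ^+ 2.
Proof.
move=> mt tk y z.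
have [h [hgeo h0 h1]] := Y_geodesic y z.
set v := velocity M h 0.
have [isq sq0] := integral_inner_mgrad y v.
set s : X -> R := fun x => riem_inner M y (mgrad M (fun y => c x y + g y) y) v.
rewrite -/s in isq sq0.
set d := Lambda / 2 * riem_dist M z y ^+ 2.
have q0 w x : 0 <= q (x, w) by exact: expR_ge0.
have iq w : rho.-integrable [set: borel X] (fun x => (q (x, w))%:E).
  apply/integrableP; split; first exact/measurable_EFinP.
  under eq_integral do rewrite gee0_abs ?lee_fin//.
  by rewrite q_mass ltry.
have itq : rho.-integrable setT (fun x => (t x * q (x, y))%:E).
  have : rho.-integrable setT (fun x => k%:E * (q (x, y))%:E)%E by exact: integrableZl.
  apply: le_integrable => //.
    by apply/measurable_EFinP; exact: measurable_funM.
  move=> x _; rewrite -EFinM !abse_EFin lee_fin !normrM ler_pM//.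
  by rewrite (le_trans (tk x))// ler_norm.
set T := \int[rho]_x (t x * q (x, y)).
have TE : T%:E = (\int[rho]_x (t x * q (x, y))%:E)%E.
  by rewrite /T /Rintegral fineK//; exact: integrable_fin_num.
set Z := \int[rho]_x (expR (t x) * q (x, z)).
have meq : measurable_fun [set: borel X] (fun x => (expR (t x) * q (x, z))%:E).
  by apply/measurable_EFinP/measurable_funM => //; exact: measurableT_comp.
have ZE : Z%:E = (\int[rho]_x (expR (t x) * q (x, z))%:E)%E.
  rewrite /Z /Rintegral fineK//; apply: integrable_fin_num => //.
  have : rho.-integrable setT (fun x => (expR k)%:E * (q (x, z))%:E)%E.
    exact: integrableZl.
  apply: le_integrable => // x _.
  rewrite -EFinM !abse_EFin lee_fin !normrM ler_pM// !ger0_norm ?expR_ge0//.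
  by rewrite ler_expR (le_trans _ (tk x))// ler_norm.
set b := T - d / eps.
suff eb : expR b <= Z.
  have Z0 : 0 < Z by apply: lt_le_trans eb; exact: expR_gt0.
  have : b <= ln Z by rewrite -[leLHS]expRK ler_ln// posrE// expR_gt0.
  have -> : Lambda / (2 * eps) * riem_dist M z y ^+ 2 = d / eps.
    by rewrite /d; field; rewrite gt_eqF.
  by rewrite /b; lra.
(* the tangent line of [expR] at [b], at the point [t x - (s x + d) / eps] of
   mean [b], times the density *)
pose l x := expR b * (1 + (t x - (s x + d) / eps - b)) * q (x, y).
pose a0 := expR b * (1 - b - d / eps).
have lE x : ((l x)%:E = a0%:E * (q (x, y))%:E + (expR b)%:E * (t x * q (x, y))%:E
    + (- (expR b / eps))%:E * (s x * q (x, y))%:E)%E.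
  transitivity (a0 * q (x, y) + expR b * (t x * q (x, y)) +
    - (expR b / eps) * (s x * q (x, y)))%:E; last by [].
  congr EFin; rewrite /l /a0; move: (q (x, y)) (expR b) => q' b'; field.
  by rewrite gt_eqF.
have i1 : rho.-integrable setT (fun x => a0%:E * (q (x, y))%:E)%E.
  exact: integrableZl.
have i2 : rho.-integrable setT (fun x => (expR b)%:E * (t x * q (x, y))%:E)%E.
  exact: integrableZl.
have i3 : rho.-integrable setT
    (fun x => (- (expR b / eps))%:E * (s x * q (x, y))%:E)%E.
  exact: integrableZl.
have i12 : rho.-integrable setT (fun x => a0%:E * (q (x, y))%:E +
    (expR b)%:E * (t x * q (x, y))%:E)%E by exact: integrableD.
have il : (\int[rho]_x (l x)%:E = (expR b)%:E)%E.
  under eq_integral do rewrite lE.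
  rewrite integralD// integralD// !integralZl// sq0 -TE q_mass mule1 mule0 adde0.
  by rewrite -EFinM -EFinD; congr EFin; rewrite /a0 /b; ring.
rewrite -lee_fin ZE -il.
have ml : measurable_fun [set: borel X] (fun x => (Num.max (l x) 0)%:E).
  apply/measurable_EFinP; apply: measurable_maxr => //; apply/measurable_EFinP.
  rewrite (_ : EFin \o l = (fun x => a0%:E * (q (x, y))%:E +
    (expR b)%:E * (t x * q (x, y))%:E +
    (- (expR b / eps))%:E * (s x * q (x, y))%:E)%E); last exact/funext.
  exact: measurable_int (integrableD measurableT i12 i3).
apply: (@le_trans _ _ (\int[rho]_x (Num.max (l x) 0)%:E)%E).
  by apply: le_integral_nomeas => x; rewrite lee_fin le_max lexx.
apply: ae_ge0_le_integral => //.
- by move=> x _; rewrite lee_fin le_max lexx orbT.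
- by move=> x _; rewrite lee_fin mulr_ge0 ?expR_ge0.
have [N [mN N0 sN]] := supp_rho; exists N; split => //.
apply: subset_trans sN; apply: subsetC => x sx _.
rewrite lee_fin ge_max mulr_ge0 ?expR_ge0// andbT.
have := (sc sx).2 z y h hgeo h0 h1; rewrite -/v -/(s x) -/d => Gx.
have -> : expR (t x) * q (x, z) =
    expR (t x - (c x z + g z - (c x y + g y)) / eps) * q (x, y).
  by rewrite -!expRD; congr expR; rewrite /=; field; rewrite gt_eqF.
apply: ler_wpM2r => //.
apply: (@le_trans _ _ (expR (t x - (s x + d) / eps))).
  set A := t x - (s x + d) / eps.
  have -> : expR A = expR b * expR (A - b) by rewrite -expRD addrC subrK.
  by rewrite ler_wpM2l ?expR_ge0// expR_ge1Dx.
by rewrite ler_expR lerD2l lerN2 ler_wpM2r// invr_ge0 ltW.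
Qed.

End semiconcave_plan.

(** * Symmetry of the Riemannian distance *)

Section reversed_curve.
Context (R : realType) (m : nat) (Y : ptopologicalType).
Variable M : riemannian_manifold R m Y.

Lemma riem_norm_ge0 y u : 0 <= riem_norm M y u.
Proof. exact: sqrtr_ge0. Qed.

Lemma riem_normN y u : riem_norm M y (- u) = riem_norm M y u.
Proof.
by rewrite /riem_norm /riem_inner raddfN/= mulNmx !mulmxN mulNmx opprK.
Qed.

Lemma curve_length_ge0 g : 0 <= curve_length M g.
Proof. by apply: Rintegral_ge0 => t _; exact: riem_norm_ge0. Qed.

Lemma riem_dist_le_length y z g : C1_curve M g -> g 0 = y -> g 1 = z ->
  riem_dist M y z <= curve_length M g.
Proof.
move=> hg g0 g1; apply: ge_inf; last by exists g.
by exists 0 => _ [h _ <-]; exact: curve_length_ge0.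
Qed.

Definition reversed (g : R -> Y) (t : R) : Y := g (1 - t).

Let onem_cvg (t : R) : (fun s : R => 1 - s) @ t --> 1 - t.
Proof. by apply: cvgB; [exact: cvg_cst|exact: cvg_id]. Qed.

Let near_onem (P : R -> Prop) (t : R) :
  (\forall u \near 1 - t, P u) -> \forall s \near t, P (1 - s).
Proof. by move=> H; exact: (@onem_cvg t P H). Qed.

Let derivable_onem (V : normedModType R) (F : R -> V) t :
  derivable F (1 - t) 1 ->
  derivable (fun s : R => F (1 - s)) t 1 /\
  derive1 (fun s : R => F (1 - s)) t = - derive1 F (1 - t).
Proof.
move=> dF.
set r := fun s : R => 1 - s : R.
have dr : is_derive t 1 r (-1).
  by rewrite -[X in is_derive _ _ _ X]add0r; apply: is_deriveB.
have fr : differentiable r t by apply/derivable1_diffP; case: dr.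
have fF : differentiable F (r t) by apply/derivable1_diffP.
have fc : differentiable (F \o r) t by exact: differentiable_comp.
split; first exact/derivable1_diffP.
transitivity ('d (F \o r) t (1 : R)); first by rewrite derive1E; exact: deriveE.
transitivity ('d F (r t) ('d r t (1 : R))).
  exact: (congr1 (fun k : R -> V => k 1) (diff_comp fr fF)).
have -> : 'd r t (1 : R) = -1 by rewrite -deriveE// derive_val.
transitivity (- 'd F (r t) (1 : R)); first by rewrite linearN.
by congr (- _); rewrite derive1E; apply/esym; exact: deriveE.
Qed.

Lemma C1_reversed g : C1_curve M g ->
  C1_curve M (reversed g) /\
  forall t : R, t \in `[0, 1] ->
    velocity M (reversed g) t = - velocity M g (1 - t).
Proof.
move=> hg.
have rt01 (t : R) : t \in `[0, 1] -> 1 - t \in `[0, 1].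
  by rewrite !in_itv/= => /andP[t0 t1]; apply/andP; split; lra.
have revE (t : R) : t \in `[0, 1] -> \forall s \near t,
    derivable (chart M (reversed g t) \o reversed g : R -> 'rV[R]_m) s 1 /\
    derive1 (chart M (reversed g t) \o reversed g : R -> 'rV[R]_m) s =
    - derive1 (chart M (g (1 - t)) \o g : R -> 'rV[R]_m) (1 - s).
  move=> /rt01 /hg[_ dg _].
  by apply: filterS (near_onem dg) => s; exact: derivable_onem.
split; last first.
  by move=> t /revE /nbhs_singleton[_].
move=> t t01; have [gc dg dc] := hg _ (rt01 _ t01); split.
- exact: continuous_comp (@onem_cvg t) gc.
- by apply: filterS (revE _ t01) => s [].
- have := nbhs_singleton (revE _ t01) => -[_ e].
  rewrite /prop_for/continuous_at e.
  apply: cvg_trans (cvgN (continuous_comp (@onem_cvg t) dc)).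
  apply: near_eq_cvg; apply: filterS (revE _ t01) => s [_ ->] //.
Qed.

(** A reversed geodesic has the same constant speed, which is also the length
    of both curves. *)
Lemma riem_dist_geodesic_sym y z h h' :
  geodesic M h -> h 0 = y -> h 1 = z ->
  geodesic M h' -> h' 0 = z -> h' 1 = y ->
  riem_dist M y z = riem_dist M z y.
Proof.
have le (a b : Y) k : geodesic M k -> k 0 = a -> k 1 = b ->
    riem_dist M b a <= riem_dist M a b.
  move=> [kC [s ks] kl] k0 k1.
  have [rC rv] := C1_reversed kC.
  rewrite -k0 -k1 -kl.
  have -> : curve_length M k = curve_length M (reversed k).
    rewrite /curve_length; apply: eq_Rintegral => t; rewrite inE/= => t01.
    rewrite rv// riem_normN ks// /reversed ks//.
    by move: t01; rewrite !in_itv/= => /andP[t0 t1]; apply/andP; split; lra.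
  apply: riem_dist_le_length => //; rewrite /reversed.
  by rewrite subr0.
  by rewrite subrr.
move=> gh h0 h1 gh' h'0 h'1; apply/eqP; rewrite eq_le.
by rewrite (le _ _ _ gh' h'0 h'1) (le _ _ _ gh h0 h1).
Qed.

End reversed_curve.

(** * Contraction and rates *)

(** [a] is the entropy after a step, [b] the one before it and [s] a lower bound
    for the decrease; all may be infinite. *)
Lemma contraction_from_increment (R : realType) (k : R) (a s b : \bar R) :
  0 < k -> (0 <= a)%E -> (a <= k%:E * s)%E -> (s + a <= b)%E ->
  (a <= (k / (1 + k))%:E * b)%E.
Proof.
move=> k0; have k1 : 0 < k / (1 + k) by rewrite divr_gt0// addr_gt0.
have [->|bfin] := eqVneq b +oo%E; first by move=> *; rewrite gt0_muley ?lte_fin// leey.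
move=> a0; case: s => [s| |]; last 2 first.
- by move: a a0 => [a| |] //= _ _; rewrite leye_eq (negbTE bfin).
- by rewrite gt0_muleNy ?lte_fin// leeNy_eq => /eqP aNy; rewrite aNy in a0.
move: a b bfin a0 => [a| |] [b| |] //=.
rewrite -!EFinM -EFinD !lee_fin => _ a0 aks sab.
rewrite mulrAC ler_pdivlMr ?addr_gt0//.
have : k * (s + a) <= k * b by rewrite ler_pM2l.
by lra.
Qed.

Section convergence.
Context (R : realType) (X : completePseudoMetricType R).
Context (m : nat) (Y : ptopologicalType) (M : riemannian_manifold R m Y).
Hypothesis Y_geodesic : forall y z : Y,
  exists g, [/\ geodesic M g, g 0 = y & g 1 = z].
Variables (rho : probability (borel X) R) (nu : probability (borel Y) R).
Hypothesis supp_rho : {ae rho, forall x, supp rho x}.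
Variable c : X -> Y -> R.
Hypothesis c_meas : measurable_fun [set: borel X * borel Y]
  (fun z => c z.1 z.2 : R).
Variable eps : R.
Hypothesis eps_gt0 : 0 < eps.
Variables (pinu : probability (borel X * borel Y)%type R).
Variables (phinu : X -> R) (psinu : Y -> R).
Hypothesis pinu_coupling : couplings rho nu pinu.
Hypothesis phinu_meas : measurable_fun [set: borel X] phinu.
Hypothesis psinu_meas : measurable_fun [set: borel Y] psinu.
Hypothesis pinu_dens :
  has_density pinu (rho \x nu)%E (eot_density c eps phinu psinu).
Variables (phi : nat -> X -> R) (psi : nat -> Y -> R).
Hypothesis phi0_meas : measurable_fun [set: borel X] (phi 0%N).
Hypothesis psiE : forall n, psi n = sinkhorn_psi_step c eps rho (phi n).
Hypothesis phiS : forall n, phi n.+1 = sinkhorn_phi_step c eps nu (psi n).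
Local Notation D n k := (eot_density c eps (phi n) (psi k)).
Hypothesis sinkhorn_int : forall n y,
  rho.-integrable [set: borel X] (fun x =>
    (expR (- (c x y + phi n x) / eps))%:E).
Variable plan : nat -> nat -> probability (borel X * borel Y)%type R.
Hypothesis plan_nn : forall n, has_density (plan n n) (rho \x nu)%E (D n n).
Hypothesis plan_Sn : forall n, has_density (plan n.+1 n) (rho \x nu)%E (D n.+1 n).
Hypothesis c_diff : forall x y, mdifferentiable M (c x) y.
Hypothesis psi_diff : forall n y, mdifferentiable M (psi n) y.
Hypothesis psi_grad : forall n y i,
  rho.-integrable [set: borel X] (fun x => (mgrad M (c x) y 0 i * D n n (x, y))%:E)
  /\ mgrad M (psi n) y 0 i = - \int[rho]_x (mgrad M (c x) y 0 i * D n n (x, y)).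
Variables (Lambda : R) (N : nat).
Hypothesis Lambda_gt0 : 0 < Lambda.
Hypothesis N_ge2 : (2 <= N)%N.
Hypothesis sc : forall x n, supp rho x -> (N.-1 <= n)%N ->
  semiconcave M Lambda (fun y => c x y + psi n y).

Local Notation a n := (rel_entropy pinu (plan n n)).
Local Notation b n := (rel_entropy pinu (plan n.+1 n)).
Local Notation mu n := (second_marginal (plan n.+1 n)).

Let mphi n : measurable_fun [set: borel X] (phi n).
Proof. exact: (measurable_sinkhorn_phi c_meas phi0_meas psiE phiS). Qed.
Let mpsi n : measurable_fun [set: borel Y] (psi n).
Proof. exact: (measurable_sinkhorn_psi c_meas phi0_meas psiE phiS). Qed.

Lemma riem_distC (y z : Y) : riem_dist M y z = riem_dist M z y.
Proof.
have [h [gh h0 h1]] := Y_geodesic y z.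
have [h' [gh' h'0 h'1]] := Y_geodesic z y.
exact: (riem_dist_geodesic_sym gh h0 h1 gh' h'0 h'1).
Qed.

Let L_gt0 : 0 < Lambda / (2 * eps).
Proof. by rewrite divr_gt0// mulr_gt0. Qed.

(** The entropy of [pinu] relative to [plan n.+1 n.+1], whose conditional laws of
    [x] are those of [plan n.+1 n], is controlled by the transport cost between
    their second marginals. *)
Lemma rel_entropy_plan_le_transport n dG (G : measurableType dG)
    (gam : probability G R) (zf yf : G -> borel Y) : (N.-1 <= n.+1)%N ->
  measurable_fun setT zf -> measurable_fun setT yf ->
  (forall A, measurable A -> nu A = gam (zf @^-1` A)) ->
  (forall A, measurable A -> mu n A = gam (yf @^-1` A)) ->
  (a n.+1 <= (Lambda / (2 * eps))%:E *
             \int[gam]_s (riem_dist M (zf s) (yf s) ^+ 2)%:E)%E.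
Proof.
move=> Nn mzf myf zlaw ylaw.
have mD := measurable_eot_density eps c_meas (mphi n.+1) (mpsi n.+1).
have D0 z : 0 < D n.+1 n.+1 z by exact: eot_density_gt0.
have D2 y : measurable_fun [set: borel X] (fun x => D n.+1 n.+1 (x, y)).
  exact: (measurableT_comp mD (pair2_measurable (y : borel Y))).
have Dmass y : (\int[rho]_x (D n.+1 n.+1 (x, y))%:E = 1)%E.
  exact: (sinkhorn_normalized2 c_meas eps_gt0 phi0_meas psiE phiS sinkhorn_int).
rewrite (rel_entropy_plans c_meas eps_gt0 phinu_meas psinu_meas (mphi n.+1)
  (mpsi n.+1) pinu_dens (plan_nn n.+1)).
apply: (integral_le_transport mD D0 Dmass _ _ L_gt0 _ pinu_coupling
  (U := fun x => (phi n.+1 x - phinu x) / eps)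
  (V := fun y => (psi n.+1 y - psinu y) / eps)
  (dist := fun y z => riem_dist M y z ^+ 2) _ _ _ _ mzf myf zlaw ylaw).
- move=> h mh h0.
  exact: (second_marginal_disintegration c_meas eps_gt0 phi0_meas psiE phiS
    sinkhorn_int plan_nn plan_Sn).
- by move=> y z; exact: sqr_ge0.
- move=> t k mt tk y z.
  apply: (semiconcave_stability eps_gt0 supp_rho D2 Dmass c_diff (psi_diff _)
    (psi_grad _) _ Y_geodesic mt tk).
  by move=> x sx; exact: sc.
- by apply: measurable_funM => //; exact: measurable_funB.
- by apply: measurable_funM => //; exact: measurable_funB.
- have [E [mE E0 sE]] := coupling_plan_mass2 c_meas phinu_meas psinu_meas
    pinu_dens pinu_coupling.
  exists E; split => //; apply: subset_trans sE; apply: subsetC => y /= y1.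
  transitivity (\int[rho]_x ((expR (- ((psi n.+1 y - psinu y) / eps)))%:E *
      (eot_density c eps phinu psinu (x, y))%:E))%E.
    apply: eq_integral => x _; rewrite -EFinM -!expRD; congr (expR _)%:E.
    by rewrite /=; field; rewrite gt_eqF.
  rewrite ge0_integralZl//.
  + by rewrite y1 mule1.
  + apply/measurable_EFinP.
    exact: (measurableT_comp (measurable_eot_density eps c_meas phinu_meas psinu_meas)
      (pair2_measurable (y : borel Y))).
  + by move=> x _; rewrite lee_fin expR_ge0.
- exact: (integral_expRN_log_ratio c_meas eps_gt0 phinu_meas psinu_meas (mphi n.+1)
  (mpsi n.+1) pinu_dens (plan_nn n.+1)).
Qed.

Let rate_gt0 tau : 0 < tau -> 0 < tau * Lambda / eps.
Proof. by move=> t0; rewrite divr_gt0// mulr_gt0. Qed.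

Let le_W2_entropy n tau (w : \bar R) (s : \bar R) :
  (a n.+1 <= (Lambda / (2 * eps))%:E * w)%E -> (w <= (2 * tau)%:E * s)%E ->
  (a n.+1 <= (tau * Lambda / eps)%:E * s)%E.
Proof.
move=> aw ws; apply: le_trans aw _.
have -> : (tau * Lambda / eps)%:E = ((Lambda / (2 * eps))%:E * (2 * tau)%:E)%E.
  by rewrite -EFinM; congr EFin; field; rewrite gt_eqF.
by rewrite -muleA; apply: lee_wpmul2l => //; rewrite lee_fin ltW.
Qed.

Let le_ereal_inf_scale (S : set (\bar R)) (x : \bar R) :
  (forall w, S w -> (x <= (Lambda / (2 * eps))%:E * w)%E) ->
  (x <= (Lambda / (2 * eps))%:E * ereal_inf S)%E.
Proof.
set L := Lambda / (2 * eps) => xS.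
have Li0 : 0 < L^-1 by rewrite invr_gt0.
have -> : x = (L%:E * (L^-1%:E * x))%E.
  by rewrite muleA -EFinM mulfV ?mul1e// gt_eqF.
apply: lee_wpmul2l; first by rewrite lee_fin ltW.
apply: le_ereal_inf_tmp => w Sw.
have -> : w = (L^-1%:E * (L%:E * w))%E.
  by rewrite muleA -EFinM mulVf ?mul1e// gt_eqF.
by apply: lee_wpmul2l; [rewrite lee_fin ltW|exact: xS].
Qed.

Let a_ge0 n : (0 <= a n)%E.
Proof.
exact: (rel_entropy_plans_ge0 c_meas eps_gt0 phinu_meas psinu_meas (mphi n)
  (mpsi n) pinu_dens (plan_nn n)).
Qed.

Let b_le_a n : (b n <= a n)%E.
Proof.
exact: (rel_entropy_phi_step_le c_meas eps_gt0 phi0_meas psiE phiS plan_nn plan_Sn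
  pinu_coupling phinu_meas psinu_meas pinu_dens).
Qed.

Let a_le_b n : (a n.+1 <= b n)%E.
Proof.
exact: (rel_entropy_psi_step_le c_meas eps_gt0 phi0_meas psiE phiS sinkhorn_int
  plan_nn plan_Sn pinu_coupling phinu_meas psinu_meas pinu_dens).
Qed.

(** Talagrand's inequality for [nu] brings in the entropy of the marginal
    relative to [nu], which the data-processing inequality bounds by the decrease
    of entropy in the step from [plan n n] to [plan n.+1 n]. *)
Lemma rel_entropy_contraction_TI_nu tau n : 0 < tau -> TI M nu tau ->
  (N.-1 <= n.+1)%N ->
  (a n.+1 <= (1 - eps / (eps + tau * Lambda))%:E * a n)%E.
Proof.
move=> t0 ti Nn; pose k := tau * Lambda / eps.
have -> : 1 - eps / (eps + tau * Lambda) = k / (1 + k).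
  have tL := mulr_gt0 t0 Lambda_gt0.
  by rewrite /k; field; rewrite !gt_eqF// addr_gt0.
apply: (contraction_from_increment (rate_gt0 t0) (a_ge0 _)
  (s := (\int[rho]_x (phi_drop eps phi n x)%:E)%E)); last first.
  rewrite [leRHS](rel_entropy_phi_step c_meas eps_gt0 phi0_meas psiE phiS plan_nn
    plan_Sn pinu_coupling phinu_meas psinu_meas pinu_dens n).
  exact: leeD2l.
have le_W2 : (a n.+1 <= (Lambda / (2 * eps))%:E * W2_sq M (mu n) nu)%E.
  apply: le_ereal_inf_scale => _ [gam gamc <-].
  under eq_integral do rewrite riem_distC.
  apply: (rel_entropy_plan_le_transport (zf := snd) (yf := fst)) => //.
    move=> A mA; rewrite -gamc.2//; congr (gam _).
    by apply/seteqP; split => -[y z] //= [].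
  move=> A mA; rewrite -gamc.1//; congr (gam _).
  by apply/seteqP; split => -[y z] //= [].
apply: le_trans (le_W2_entropy le_W2 (ti (mu n))) _.
apply: lee_wpmul2l; first by rewrite lee_fin ltW// rate_gt0.
exact: (rel_entropy_marginal_nu_le c_meas eps_gt0 phi0_meas psiE phiS sinkhorn_int
  plan_nn plan_Sn).
Qed.

(** Talagrand's inequality for the marginal brings in the entropy of [nu]
    relative to it, which is exactly the decrease of entropy in the step from
    [plan n.+1 n] to [plan n.+1 n.+1]. *)
Lemma rel_entropy_contraction_TI_marginal tau n : 0 < tau -> TI M (mu n) tau ->
  (N.-1 <= n.+1)%N ->
  (a n.+1 <= (1 - eps / (eps + tau * Lambda))%:E * b n)%E.
Proof.
move=> t0 ti Nn; pose k := tau * Lambda / eps.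
have -> : 1 - eps / (eps + tau * Lambda) = k / (1 + k).
  have tL := mulr_gt0 t0 Lambda_gt0.
  by rewrite /k; field; rewrite !gt_eqF// addr_gt0.
apply: (contraction_from_increment (rate_gt0 t0) (a_ge0 _)
  (s := rel_entropy nu (mu n))); last first.
  by rewrite [leRHS](rel_entropy_psi_step c_meas eps_gt0 phi0_meas psiE phiS
    sinkhorn_int plan_nn plan_Sn pinu_coupling phinu_meas psinu_meas pinu_dens n).
have le_W2 : (a n.+1 <= (Lambda / (2 * eps))%:E * W2_sq M nu (mu n))%E.
  apply: le_ereal_inf_scale => _ [gam gamc <-].
  apply: (rel_entropy_plan_le_transport (zf := fst) (yf := snd)) => //.
    move=> A mA; rewrite -gamc.1//; congr (gam _).
    by apply/seteqP; split => -[y z] //= [].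
  move=> A mA; rewrite -gamc.2//; congr (gam _).
  by apply/seteqP; split => -[y z] //= [].
exact: le_W2_entropy le_W2 (ti nu).
Qed.

Let a_le_a0 n : (a n <= a 0%N)%E.
Proof. by elim: n => // n; apply: le_trans; exact: le_trans (a_le_b n) (b_le_a n). Qed.

Lemma sinkhorn_rate_TI_nu tau n : 0 < tau -> TI M nu tau -> (N.-1 <= n)%N ->
  (b n <= ((1 - Num.min (tau * Lambda) eps /
      (Num.min (tau * Lambda) eps + tau * Lambda)) ^+ (n + 2 - N))%:E * a 0%N)%E.
Proof.
move=> t0 ti Nn; apply: le_trans (b_le_a n) _.
set th := 1 - _.
have tL : 0 < tau * Lambda by rewrite mulr_gt0.
(* the rate obtained is at least as good as the stated one, which is [1 / 2]
   for [tau * Lambda <= eps] *)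
have th_ge : 1 - eps / (eps + tau * Lambda) <= th.
  rewrite /th lerD2l lerN2; case: (leP (tau * Lambda) eps) => // le_eps.
  rewrite -subr_ge0 (_ : _ - _ = (eps - tau * Lambda) / (2 * (eps + tau * Lambda))).
    by rewrite divr_ge0 ?subr_ge0// mulr_ge0// ltW// addr_gt0.
  by field; rewrite !gt_eqF// addr_gt0.
have th0 : 0 <= th.
  apply: le_trans th_ge.
  by rewrite subr_ge0 ler_pdivrMr ?addr_gt0// mul1r lerDl ltW.
have [j ->] : exists j, n = (N - 2 + j)%N by exists (n - (N - 2))%N; lia.
rewrite (_ : (N - 2 + j + 2 - N = j)%N); last by lia.
elim: j => [|j IH]; first by rewrite expr0 mul1e addn0; exact: a_le_a0.
rewrite addnS exprS EFinM -muleA.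
apply: (@le_trans _ _ (th%:E * a (N - 2 + j)%N)%E); last first.
  by apply: lee_wpmul2l => //; rewrite lee_fin.
have Nj : (N.-1 <= (N - 2 + j).+1)%N by lia.
apply: le_trans (rel_entropy_contraction_TI_nu t0 ti Nj) _.
by apply: lee_wpmul2r => //; rewrite lee_fin.
Qed.

Lemma sinkhorn_rate_TI_marginal tau n : 0 < tau ->
  (forall n, (N <= n)%N -> TI M (second_marginal (plan n n.-1)) tau) ->
  (N <= n)%N ->
  (b n <= ((1 - eps / (eps + tau * Lambda)) ^+ (n + 1 - N))%:E * a 0%N)%E.
Proof.
move=> t0 ti Nn; set th := 1 - _.
have tL : 0 < tau * Lambda by rewrite mulr_gt0.
have th0 : 0 <= th.
  by rewrite subr_ge0 ler_pdivrMr ?addr_gt0// mul1r lerDl ltW.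
have [j ->] : exists j, n = (N.-1 + j)%N by exists (n - N.-1)%N; lia.
rewrite (_ : (N.-1 + j + 1 - N = j)%N); last by lia.
elim: j => [|j IH].
  by rewrite expr0 mul1e addn0; exact: le_trans (b_le_a _) (a_le_a0 _).
rewrite addnS exprS EFinM -muleA; apply: le_trans (b_le_a _) _.
apply: (@le_trans _ _ (th%:E * b (N.-1 + j)%N)%E); last first.
  by apply: lee_wpmul2l => //; rewrite lee_fin.
apply: rel_entropy_contraction_TI_marginal => //; last by lia.
by apply: (ti (N.-1 + j).+1); lia.
Qed.

End convergence.

Theorem mainTheorem3
    (R : realType)
    (X : completePseudoMetricType R) (X_polish : polish X)
    (m : nat) (Y : ptopologicalType) (M : riemannian_manifold R m Y)
    (Y_connected : connected [set: Y])
    (Y_geodesic : forall y z : Y,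
       exists g, [/\ geodesic M g, g 0 = y & g 1 = z])
    (rho : probability (borel X) R) (nu : probability (borel Y) R)
    (c : X -> Y -> R)
    (c_meas : measurable_fun [set: borel X * borel Y]
                (fun z => c z.1 z.2 : R))
    (eps : R) (eps_gt0 : 0 < eps)
    (pinu : probability (borel X * borel Y)%type R)
    (phinu : X -> R) (psinu : Y -> R)
    (pinu_min : unique_eot_minimizer c eps rho nu pinu)
    (phinu_meas : measurable_fun [set: borel X] phinu)
    (psinu_meas : measurable_fun [set: borel Y] psinu)
    (pinu_dens : has_density pinu (rho \x nu)%E (eot_density c eps phinu psinu))
    (phi0 : X -> R) (phi0_meas : measurable_fun [set: borel X] phi0)
    (sinkhorn_int : forall n y,
       rho.-integrable [set: borel X] (fun x =>
         (expR (- (c x y + sinkhorn_phi c eps rho nu phi0 n x) / eps))%:E))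
    (plan : nat -> nat -> probability (borel X * borel Y)%type R)
    (plan_nn : forall n, has_density (plan n n) (rho \x nu)%E
       (eot_density c eps (sinkhorn_phi c eps rho nu phi0 n)
                          (sinkhorn_psi c eps rho nu phi0 n)))
    (plan_Sn : forall n, has_density (plan n.+1 n) (rho \x nu)%E
       (eot_density c eps (sinkhorn_phi c eps rho nu phi0 n.+1)
                          (sinkhorn_psi c eps rho nu phi0 n)))
    (psi_diff : forall n y,
       mdifferentiable M (sinkhorn_psi c eps rho nu phi0 n) y)
    (psi_grad : forall n y i,
       let dens x := eot_density c eps (sinkhorn_phi c eps rho nu phi0 n)
                       (sinkhorn_psi c eps rho nu phi0 n) (x, y) in
       rho.-integrable [set: borel X]
         (fun x => (mgrad M (c x) y 0 i * dens x)%:E) /\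
       mgrad M (sinkhorn_psi c eps rho nu phi0 n) y 0 i
         = - \int[rho]_x (mgrad M (c x) y 0 i * dens x))
    (c_C1 : forall x, C1_fun M (c x))
    (Lambda : R) (Lambda_gt0 : 0 < Lambda) (N : nat) (N_ge2 : (2 <= N)%N)
    (sc : forall x n, supp rho x -> (N.-1 <= n)%N ->
       semiconcave M Lambda
         (fun y => c x y + sinkhorn_psi c eps rho nu phi0 n y)) :
  (forall tau : R, 0 < tau -> TI M nu tau ->
    forall n, (N.-1 <= n)%N ->
      (rel_entropy pinu (plan n.+1 n.+1) <= rel_entropy pinu (plan n.+1 n))%E /\
      (rel_entropy pinu (plan n.+1 n) <=
         ((1 - Num.min (tau * Lambda) eps /
               (Num.min (tau * Lambda) eps + tau * Lambda))
            ^+ (n + 2 - N))%:E * rel_entropy pinu (plan 0%N 0%N))%E)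
  /\
  (forall tau : R, 0 < tau ->
    (forall n, (N <= n)%N -> TI M (second_marginal (plan n n.-1)) tau) ->
    forall n, (N <= n)%N ->
      (rel_entropy pinu (plan n.+1 n.+1) <= rel_entropy pinu (plan n.+1 n))%E /\
      (rel_entropy pinu (plan n.+1 n) <=
         ((1 - eps / (eps + tau * Lambda))
            ^+ (n + 1 - N))%:E * rel_entropy pinu (plan 0%N 0%N))%E).
Proof.
have supp_rho := supp_ae rho X_polish.
have c_diff x y : mdifferentiable M (c x) y := C1_fun_mdifferentiable y (c_C1 x).
have pinu_coupling := pinu_min.1.
pose phi := sinkhorn_phi c eps rho nu phi0.
pose psi := sinkhorn_psi c eps rho nu phi0.
have psiE n : psi n = sinkhorn_psi_step c eps rho (phi n) by [].
have phiS n : phi n.+1 = sinkhorn_phi_step c eps nu (psi n) by [].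
have psi_step_le := rel_entropy_psi_step_le c_meas eps_gt0
  (phi0_meas : measurable_fun [set: borel X] (phi 0%N)) psiE phiS sinkhorn_int
  plan_nn plan_Sn pinu_coupling phinu_meas psinu_meas pinu_dens.
split=> tau tau_gt0 ti n Nn; split => //.
- exact: (sinkhorn_rate_TI_nu Y_geodesic supp_rho c_meas eps_gt0 pinu_coupling
    phinu_meas psinu_meas pinu_dens
    (phi0_meas : measurable_fun [set: borel X] (phi 0%N)) psiE phiS sinkhorn_int
    plan_nn plan_Sn c_diff psi_diff psi_grad Lambda_gt0 N_ge2 sc tau_gt0 ti Nn).
- exact: (sinkhorn_rate_TI_marginal Y_geodesic supp_rho c_meas eps_gt0
    pinu_coupling phinu_meas psinu_meas pinu_dens
    (phi0_meas : measurable_fun [set: borel X] (phi 0%N)) psiE phiS sinkhorn_int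
    plan_nn plan_Sn c_diff psi_diff psi_grad Lambda_gt0 N_ge2 sc tau_gt0 ti Nn).
Qed.
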